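(* Let $y(x;\varepsilon)$ be the classical solution of the Cauchy problem $$\varepsilon^m y^{(m)}=\varepsilon^{m-1}a_{m-1}(x)y^{(m-1)}+\dots+a_0(x)y+b(x),\quad x\in(0,X],$$ $$y(0;\varepsilon)=y^0,\ \ \frac{dy}{dx}(0;\varepsilon)=\frac{y^1}{\varepsilon},\ \ \ldots,\ \ \frac{d^{m-1}y}{dx^{m-1}}(0;\varepsilon)=\frac{y^{m-1}}{\varepsilon^{m-1}},$$ and let the functions $y^i_n(x;\varepsilon)$ ($1\le i\le m$, $n\in\{0,1,2,\dots\}$) and the constants $\gamma_0\in(0,1)$, $\varepsilon_0\in(0,+\infty]$, $C_0\ge 0$ be as defined in the context. Then for every integer $n\ge 0$ and every $\varepsilon\in(0,\varepsilon_0]$ (with $\varepsilon$ finite), $$\big\|y(\cdot;\varepsilon)-y^1_n(\cdot;\varepsilon)\big\|\le C_0\,\varepsilon\left(\gamma_0\frac{\varepsilon}{\varepsilon_0}\right)^n,$$ $$\left\|\frac{d^{i-1}}{dx^{i-1}}y(\cdot;\varepsilon)-y^i_n(\cdot;\varepsilon)\right\|\le C_0\,\varepsilon^{2-i}\left(\gamma_0\frac{\varepsilon}{\varepsilon_0}\right)^n,\qquad i=2,\dots,m,$$ where $\|\cdot\|$ is the maximum norm of $C[0,X]$. In particular, for each $\varepsilon\in(0,\varepsilon_0]$ the sequence $\psi_n(x;\varepsilon)=(y^1_n(x;\varepsilon),\dots,y^m_n(x;\varepsilon))$ converges, as $n\to\infty$, in the norm of $C_m[0,X]$ (continuous $m$-dimensional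 vector-functions on $[0,X]$ with the maximum norm) to $\big(y,\frac{dy}{dx},\dots,\frac{d^{m-1}y}{dx^{m-1}}\big)(x;\varepsilon)$.
   Context: Setting. $m\ge1$ is an integer, $X>0$, $\varepsilon>0$, $y^0,\dots,y^{m-1}\in\mathbb{R}$ (upper indices on these constants, and on $y^i_n$, $z^i$, $\Phi^j$, are labels, not powers), and $a_0,\dots,a_{m-1},b\in C^1[0,X]$ are real-valued. For every $x\in[0,X]$ the Routh--Hurwitz condition holds: for each $k=1,\dots,m$, $(-1)^k\det\big(a_{ij}(x)\big)_{i,j=0}^{k-1}>0$, where $a_{ij}(x)=a_{2i-j}(x)$ if $0\le 2i-j<m$, $a_{ij}(x)=-1$ if $2i-j=m$, and $a_{ij}(x)=0$ if $2i-j<0$ or $2i-j>m$. (This is equivalent to all roots of $\lambda^m-a_{m-1}(x)\lambda^{m-1}-\dots-a_0(x)$ having negative real part.) Auxiliary functions. $\bar y(x)=-b(x)/a_0(x)$. $\Pi(\xi)$, $\xi\ge0$, is the solution of $\frac{d^m\Pi}{d\xi^m}=a_{m-1}(0)\frac{d^{m-1}\Pi}{d\xi^{m-1}}+\dots+a_0(0)\Pi$ with $\Pi(0)=y^0-\bar y(0)$ and $\Pi^{(k)}(0)=y^k$ for $1\le k\le m-1$. $\tilde y(\xi,x)=\bar y(x)+\Pi(\xi)$. For each $x\in[0,X]$, $\Phi^1(\xi;x)$ and $\Phi^m(\xi;x)$, $\xi\in\mathbb{R}$, are the solutions of $\frac{d^m\Phi}{d\xi^m}=a_{m-1}(x)\frac{d^{m-1}\Phi}{d\xi^{m-1}}+\dots+a_0(x)\Phi$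 with initial data at $\xi=0$: $\Phi^1=1$ and all derivatives of orders $1,\dots,m-1$ equal to $0$; respectively all derivatives of $\Phi^m$ of orders $0,\dots,m-2$ equal to $0$ and that of order $m-1$ equal to $1$ (for $m=1$ both equal $1$ at $\xi=0$). $\Phi^j_{\xi^k}$ denotes the $k$th derivative in $\xi$. $f(\xi;\varepsilon)=\varepsilon^{-1}\sum_{k=0}^{m-1}[a_k(\varepsilon\xi)-a_k(0)]\Pi^{(k)}(\xi)$ if $m\ge2$, and $f(\xi;\varepsilon)=\varepsilon^{-1}[a_0(\varepsilon\xi)-a_0(0)]\Pi(\xi)-\bar y'(\varepsilon\xi)$ if $m=1$. Operator. $\widehat A(\varepsilon)=(\widehat A_1(\varepsilon),\dots,\widehat A_m(\varepsilon))$ maps $C_m[0,X/\varepsilon]$ (continuous $\mathbb{R}^m$-valued functions on $[0,X/\varepsilon]$) to itself by $$\widehat A_i(\varepsilon)[z^1,\dots,z^m](\xi)=-\int_0^\xi\Phi^1_{\xi^{i-1}}(\xi-\zeta;\varepsilon\xi)\,\bar y'(\varepsilon\zeta)\,d\zeta+\int_0^\xi\Phi^m_{\xi^{i-1}}(\xi-\zeta;\varepsilon\xi)\Big\{\sum_{k=0}^{m-1}[a_k(\varepsilon\zeta)-a_k(\varepsilon\xi)]z^{k+1}(\zeta)+f(\zeta;\varepsilon)\Big\}d\zeta,$$ where the first integral is present only for $m\ge2$. Iterations. $\varphi_0\equiv(0,\dots,0)$ and $\varphi_n=(z^1_n,\dots,z^m_n)=\widehat A(\varepsilon)[\varphi_{n-1}]$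 for $n\ge1$. Put $y^1_n(x;\varepsilon)=\tilde y(x/\varepsilon,x)+\varepsilon z^1_n(x/\varepsilon;\varepsilon)$ and $y^i_n(x;\varepsilon)=\varepsilon^{1-i}\Pi^{(i-1)}(x/\varepsilon)+\varepsilon^{2-i}z^i_n(x/\varepsilon;\varepsilon)$ for $2\le i\le m$. Constants. $\chi=-\max_{x\in[0,X]}\max_i\operatorname{Re}\lambda_i(x)>0$, where $\lambda_1(x),\dots,\lambda_m(x)$ are the roots of $\lambda^m-a_{m-1}(x)\lambda^{m-1}-\dots-a_0(x)$. $C_\Phi>0$ is a constant with $|\Phi^1_{\xi^i}(\xi;x)|,|\Phi^m_{\xi^i}(\xi;x)|\le C_\Phi(1+\xi^{m-1})e^{-\chi\xi}$ for all $i\in\{0,\dots,m-1\}$, $\xi\ge0$, $x\in[0,X]$. $\tilde C$ is a constant with $|\Pi^{(i)}(\xi)|\le\tilde C(1+\xi^{m-1})e^{-\chi\xi}$ for all $i\in\{0,\dots,m-1\}$, $\xi\ge0$ (such constants exist). With $\|\cdot\|$ the maximum norm on $[0,X]$, let $\alpha=\sum_{k=0}^{m-1}\|a_k'\|$, $\beta=\alpha\frac{\chi^{m-1}+m!}{\chi^{m+1}}$, $\gamma=\Big\{\tilde C\alpha\max_{\zeta>0}[(\zeta+\zeta^m)e^{-\chi\zeta}]+\|\bar y'\|\Big\}\frac{\chi^{m-1}+(m-1)!}{\chi^m}$. Let $\gamma_0\in(0,1)$ be arbitrary, $\varepsilon_0=\gamma_0(C_\Phi\beta)^{-1}$ (with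 $\varepsilon_0=+\infty$ if $\beta=0$, in which case $\varepsilon/\varepsilon_0$ is read as $0$ and $0^0=1$), and $C_0=C_\Phi\gamma/(1-\gamma_0)$. *)

(* Defs.v *)
(* Real analysis is done over the classical reals of Stdlib (derivatives and
   limits from Stdlib, integrals and suprema from Coquelicot); matrices,
   polynomials and complex numbers are those of Mathematical Components,
   through the algebraic structure that Rstruct puts on the type R. *)
From Stdlib Require Import Reals.
From Coquelicot Require Import Rbar Lub Hierarchy RInt.
From mathcomp Require Import all_boot all_algebra.
From mathcomp Require Import Rstruct complex.

Set Implicit Arguments.
Unset Strict Implicit.
Unset Printing Implicit Defensive.

Local Open Scope R_scope.

Definition Icc (u v x : R) : Prop := u <= x <= v.

(** Calculus relative to a domain [D]: [D_in] and [continue_in] take limits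
    within [D], so they are one-sided at the ends of an interval. *)

Definition deriv_on (D : R -> Prop) (g dg : R -> R) : Prop :=
  forall x, D x -> D_in g dg D x.

Definition cont_on (D : R -> Prop) (g : R -> R) : Prop :=
  forall x, D x -> continue_in g D x.

Definition C1_on (D : R -> Prop) (g : R -> R) : Prop :=
  exists dg, deriv_on D g dg /\ cont_on D dg.

(** [u k] is the [k]-th derivative of [u 0] on [D], for [k <= m], and [u 0]
    solves u^(m) = c_(m-1) u^(m-1) + ... + c_0 u on [D]. *)
Definition lin_ode_sol (D : R -> Prop) (m : nat) (c : nat -> R)
    (u : nat -> R -> R) : Prop :=
  (forall k, (k < m)%N -> deriv_on D (u k) (u k.+1)) /\
  (forall t, D t -> u m t = sum_f_R0 (fun k => c k * u k t) m.-1).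

(** Maximum norms on C[0,X] and C_m[0,X].  They are suprema in the extended
    reals, so that a finite upper bound is never vacuous. *)

Definition supnorm (X : R) (g : R -> R) : Rbar :=
  Lub_Rbar (fun r => exists x, Icc 0 X x /\ r = Rabs (g x)).

Definition supnorm_vec (m : nat) (X : R) (g : nat -> R -> R) : Rbar :=
  Lub_Rbar (fun r => exists i x,
    (1 <= i <= m)%N /\ Icc 0 X x /\ r = Rabs (g i x)).

(** Components of vector functions are numbered from 1 to [m]. *)
Definition converges_Cm (m : nat) (X : R)
    (psi : nat -> nat -> R -> R) (g : nat -> R -> R) : Prop :=
  (forall n i, (1 <= i <= m)%N -> cont_on (Icc 0 X) (psi n i)) /\
  (forall i, (1 <= i <= m)%N -> cont_on (Icc 0 X) (g i)) /\
  (forall delta, 0 < delta -> exists N : nat, forall n, (N <= n)%N ->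
     Rbar_lt (supnorm_vec m X (fun i x => psi n i x - g i x)) delta).

Definition is_max (S : R -> Prop) (v : R) : Prop :=
  S v /\ forall r, S r -> r <= v.

(** In the next definitions [c k] stands for a_k(x) at a fixed [x]. *)

Definition hurwitz_entry (m : nat) (c : nat -> R) (i j : nat) : R :=
  if (j <= 2 * i)%N then
    if (2 * i - j < m)%N then c (2 * i - j)%N
    else if (2 * i - j == m)%N then -1 else 0
  else 0.

Definition hurwitz_det (m : nat) (c : nat -> R) (k : nat) : R :=
  (\det (\matrix_(i < k, j < k) hurwitz_entry m c i j))%R.

Definition routh_hurwitz (m : nat) (c : nat -> R) : Prop :=
  forall k, (1 <= k <= m)%N -> 0 < (-1) ^ k * hurwitz_det m c k.

Definition charpoly (m : nat) (c : nat -> R) : {poly R[i]} :=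
  ('X^m - \poly_(k < m) (c k)%:C%C)%R.

Definition is_chi (m : nat) (X : R) (a : nat -> R -> R) (chi : R) : Prop :=
  is_max (fun r => exists x (lambda : R[i]),
            Icc 0 X x /\ root (charpoly m (fun k => a k x)) lambda /\
            r = complex.Re lambda)
         (- chi).

(** [Pi k] is the [k]-th derivative of Pi; [Phi1 x k]
    and [Phim x k] are the [k]-th derivatives in xi of Phi^1(xi; x) and
    Phi^m(xi; x). *)

Definition ybar (a : nat -> R -> R) (b : R -> R) (x : R) : R := - b x / a 0%N x.

Definition is_Pi (m : nat) (a : nat -> R -> R) (b : R -> R) (y0 : nat -> R)
    (Pi : nat -> R -> R) : Prop :=
  lin_ode_sol (fun xi => 0 <= xi) m (fun k => a k 0) Pi /\
  Pi 0%N 0 = y0 0%N - ybar a b 0 /\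
  (forall k, (1 <= k < m)%N -> Pi k 0 = y0 k).

Definition is_Phi1 (m : nat) (X : R) (a : nat -> R -> R)
    (Phi1 : R -> nat -> R -> R) : Prop :=
  forall x, Icc 0 X x ->
    lin_ode_sol (fun _ => True) m (fun k => a k x) (Phi1 x) /\
    forall k, (k < m)%N -> Phi1 x k 0 = if k == 0%N then 1 else 0.

Definition is_Phim (m : nat) (X : R) (a : nat -> R -> R)
    (Phim : R -> nat -> R -> R) : Prop :=
  forall x, Icc 0 X x ->
    lin_ode_sol (fun _ => True) m (fun k => a k x) (Phim x) /\
    forall k, (k < m)%N -> Phim x k 0 = if k == m.-1 then 1 else 0.

Definition ytilde (a : nat -> R -> R) (b : R -> R) (Pi : nat -> R -> R)
    (xi x : R) : R := ybar a b x + Pi 0%N xi.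

(** [dybar] is the derivative of ybar on [0,X]. *)
Definition fterm (m : nat) (a : nat -> R -> R) (dybar : R -> R)
    (Pi : nat -> R -> R) (eps xi : R) : R :=
  / eps * sum_f_R0 (fun k => (a k (eps * xi) - a k 0) * Pi k xi) m.-1
  - (if m == 1%N then dybar (eps * xi) else 0).

Definition Ahat (m : nat) (a : nat -> R -> R) (dybar : R -> R)
    (Pi : nat -> R -> R) (Phi1 Phim : R -> nat -> R -> R) (eps : R)
    (z : nat -> R -> R) (i : nat) (xi : R) : R :=
  - (if (2 <= m)%N then
       RInt (fun zeta =>
         Phi1 (eps * xi) i.-1 (xi - zeta) * dybar (eps * zeta)) 0 xi
     else 0)
  + RInt (fun zeta =>
      Phim (eps * xi) i.-1 (xi - zeta) *
      (sum_f_R0 (fun k => (a k (eps * zeta) - a k (eps * xi)) * z k.+1 zeta)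
         m.-1
       + fterm m a dybar Pi eps zeta)) 0 xi.

Fixpoint phi_iter (m : nat) (a : nat -> R -> R) (dybar : R -> R)
    (Pi : nat -> R -> R) (Phi1 Phim : R -> nat -> R -> R) (eps : R)
    (n : nat) : nat -> R -> R :=
  match n with
  | O => fun _ _ => 0
  | S n' => Ahat m a dybar Pi Phi1 Phim eps
              (phi_iter m a dybar Pi Phi1 Phim eps n')
  end.

(** [y_iter ... n i x] is y^i_n(x; eps), for [1 <= i <= m]. *)
Definition y_iter (m : nat) (a : nat -> R -> R) (b dybar : R -> R)
    (Pi : nat -> R -> R) (Phi1 Phim : R -> nat -> R -> R) (eps : R)
    (n i : nat) (x : R) : R :=
  let z := phi_iter m a dybar Pi Phi1 Phim eps n in
  if i == 1%N then ytilde a b Pi (x / eps) x + eps * z 1%N (x / eps)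
  else / eps ^ (i - 1) * Pi (i - 1)%N (x / eps)
       + / eps ^ (i - 2) * z i (x / eps).

Definition Phi_bound (m : nat) (X : R) (Phi : R -> nat -> R -> R)
    (chi CPhi : R) : Prop :=
  forall i xi x, (i < m)%N -> 0 <= xi -> Icc 0 X x ->
    Rabs (Phi x i xi) <= CPhi * (1 + xi ^ m.-1) * exp (- chi * xi).

Definition Pi_bound (m : nat) (Pi : nat -> R -> R) (chi Ct : R) : Prop :=
  forall i xi, (i < m)%N -> 0 <= xi ->
    Rabs (Pi i xi) <= Ct * (1 + xi ^ m.-1) * exp (- chi * xi).

(** [da k] is the derivative of a_k on [0,X]. *)
Definition alpha (m : nat) (X : R) (da : nat -> R -> R) : R :=
  sum_f_R0 (fun k => real (supnorm X (da k))) m.-1.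

Definition beta (m : nat) (X : R) (da : nat -> R -> R) (chi : R) : R :=
  alpha m X da * ((chi ^ m.-1 + INR m`!) / chi ^ m.+1).

Definition gamma (m : nat) (X : R) (da : nat -> R -> R) (dybar : R -> R)
    (chi Ct : R) : R :=
  (Ct * alpha m X da
     * real (Lub_Rbar (fun r => exists zeta,
         0 < zeta /\ r = (zeta + zeta ^ m) * exp (- chi * zeta)))
   + real (supnorm X dybar))
  * ((chi ^ m.-1 + INR (m.-1)`!) / chi ^ m).

Definition eps0 (m : nat) (X : R) (da : nat -> R -> R)
    (chi CPhi gamma0 : R) : Rbar :=
  let bt := beta m X da chi in
  if Req_EM_T bt 0 then p_infty else Rbar.Finite (gamma0 * / (CPhi * bt)).

(** eps / eps0; this is 0 when eps0 is infinite. *)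
Definition eps_ratio (m : nat) (X : R) (da : nat -> R -> R)
    (chi CPhi gamma0 eps : R) : R :=
  real (Rbar_div (Rbar.Finite eps) (eps0 m X da chi CPhi gamma0)).

Definition C0 (m : nat) (X : R) (da : nat -> R -> R) (dybar : R -> R)
    (chi CPhi Ct gamma0 : R) : R :=
  CPhi * gamma m X da dybar chi Ct / (1 - gamma0).

(** [y k], for [k <= m], is the [k]-th derivative of the classical solution
    [y 0] of the Cauchy problem: y is of class C^(m-1) on [0,X], has an m-th
    derivative on (0,X], and satisfies the equation there. *)
Definition classical_solution (m : nat) (X : R) (a : nat -> R -> R)
    (b : R -> R) (y0 : nat -> R) (eps : R) (y : nat -> R -> R) : Prop :=
  (forall k, (k.+1 < m)%N -> deriv_on (Icc 0 X) (y k) (y k.+1)) /\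
  cont_on (Icc 0 X) (y m.-1) /\
  (forall x, 0 < x <= X ->
     D_in (y m.-1) (y m) (Icc 0 X) x /\
     eps ^ m * y m x =
       sum_f_R0 (fun k => eps ^ k * a k x * y k x) m.-1 + b x) /\
  (forall k, (k < m)%N -> y k 0 = y0 k / eps ^ k).

(* Main.v *)
(** In the stretched variable xi = x / eps the remainder z = (solution - leading
    term) / eps solves a linear system with slowly varying coefficients a_k(eps xi).
    Freezing them at the end point eps xi and applying the variation of constants
    formula shows that z is a fixed point of Ahat.  As
    |a_k(eps zeta) - a_k(eps xi)| <= ||a_k'|| eps |xi - zeta|, the exponential decay
    of Phi^m makes Ahat a contraction with constant
    q = eps C_Phi beta <= gamma_0; hence ||z|| <= C_0 and ||z - phi_n|| <= C_0 q^n.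

    The decay rate chi is positive by the Routh-Hurwitz criterion, proved by the Routh
    reduction: writing the polynomial as E(w) + w O(w) with E, O even, each reduction
    step keeps Re (E conj(w O)) >= 0 on the closed right half-plane, where E and w O
    have no common zero. *)
Require Import Defs.
From Stdlib Require Import Reals Lra Psatz.
From Coquelicot Require Import Coquelicot.
From mathcomp Require Import all_boot all_order all_algebra.
From mathcomp Require Import Rstruct complex.
From mathcomp Require zify ring lra.

(** No fixed-point theorem is invoked: the given classical solution supplies the fixed point, so
    only estimates remain. Variation of constants between two frozen points even gives a Lipschitz
    bound, uniform in time because the kernels decay exponentially. Two kernels occur because the
    first-order system for z is forced in two places: ybar' enters its first equation and f its last
    one; for m = 1 these are the same equation. The constants are moments of the kernel bound over
    the half-line. With m = n + 1, the integral of (1 + s^n) exp(- chi s) is (chi^n + n!) /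
    chi^(n+1), which enters gamma; an extra factor s, produced by the Lipschitz bound on the a_k,
    gives (chi^n + (n+1)!) / chi^(n+2), which enters beta. *)

Set Implicit Arguments.
Unset Strict Implicit.
Unset Printing Implicit Defensive.

(** * The Routh-Hurwitz criterion *)

Section RouthHurwitz.
Import Order.TTheory GRing.Theory Num.Theory.
Import zify ring lra.
Local Open Scope ring_scope.
Variable R : rcfType.
Implicit Types (p : nat -> R) (w : R[i]) (k N : nat).

(* Coefficients are ascending and indices start at 0: this is the usual Hurwitz
   matrix of the reversed polynomial, bordered by the row (p_0, 0, ..., 0). *)
Definition hurwitz_mx p k : 'M[R]_k :=
  \matrix_(i < k, j < k) (if (j <= i.*2)%N then p (i.*2 - j)%N else 0).

(** With p(w) = E(w) + w O(w) and c = p_0 / p_1, these are the coefficients of (p(w) - c O(w)) / w: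
    the constant term is cancelled and the degree drops by one. The new even part is O. *)
Definition routh_step p k : R :=
  if odd k then p k.+1 - p 0%N / p 1%N * p k.+2 else p k.+1.

Lemma det_hurwitz_mx1 p : \det (hurwitz_mx p 1) = p 0%N.
Proof. by rewrite det_mx11 mxE. Qed.

Lemma det_hurwitz_mx2 p : \det (hurwitz_mx p 2) = p 0%N * p 1%N.
Proof.
rewrite (expand_det_row _ ord0) !big_ord_recl big_ord0 !mxE /= mul0r !addr0.
by rewrite /cofactor expr0 mul1r det_mx11 !mxE.
Qed.

(** The first row is (p_0, 0, ..., 0), so only the minor without the first row and column survives.
    That minor is the matrix of the reduced polynomial after adding c times the preceding column to
    each odd column. *)
Lemma det_hurwitz_step p k : p 1%N != 0 ->
  \det (hurwitz_mx p k.+1) = p 0%N * \det (hurwitz_mx (routh_step p) k).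
Proof.
move=> p1; set c := p 0%N / p 1%N.
rewrite (expand_det_row _ ord0) big_ord_recl big1 => [|j _]; last by rewrite !mxE mul0r.
rewrite addr0 mxE /cofactor expr0 mul1r; congr (_ * _).
(* [U] undoes the column operations of the Routh reduction. *)
pose U : 'M[R]_k := \matrix_(l, j)
  ((l == j)%:R + (odd j && (l.+1 == j))%:R * c).
suff -> : row' ord0 (col' ord0 (hurwitz_mx p k.+1)) = hurwitz_mx (routh_step p) k *m U.
  rewrite det_mulmx; suff -> : \det U = 1 by rewrite mulr1.
  have trigU : is_trig_mx U^T.
    apply/is_trig_mxP => i j ij; rewrite !mxE.
    have -> : (j == i) = false by apply/eqP => e; move: ij; rewrite e ltnn.
    by rewrite (gtn_eqF (ltnW ij : (i < j.+1)%N)) andbF mul0r addr0.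
  rewrite -det_tr det_trig // big1 // => i _; rewrite !mxE eqxx.
  by rewrite (gtn_eqF (ltnSn i)) andbF mul0r addr0.
apply/matrixP => i j; rewrite !mxE.
under eq_bigr => l _ do rewrite !mxE mulrDr.
rewrite big_split /= (bigD1 j) //= eqxx mulr1 big1 ?addr0; last first.
  by move=> l /negPf ->; rewrite mulr0.
have cE : c * p 1%N = p 0%N by rewrite divfK.
case: (boolP (odd j)) => oj; last first.
  rewrite big1 ?addr0; last by move=> l _; rewrite mul0r mulr0.
  rewrite /routh_step /bump /= !add1n.
  case: (leqP j i.*2) => ji.
    have -> : (j < i.+1.*2)%N by lia.
    have -> : odd (i.*2 - j) = false by rewrite oddB // odd_double (negPf oj).
    by have -> : (i.+1.*2 - j.+1)%N = (i.*2 - j).+1 by lia.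
  have jE := even_halfK oj.
  by have -> : (j < i.+1.*2)%N = false by lia.
case: j oj => -[|j] //= jk oj.
have jk' : (j < k)%N by lia.
rewrite (bigD1 (Ordinal jk')) //= eqxx mul1r big1 ?addr0; last first.
  move=> l ne; have -> : (l.+1 == j.+1) = false.
    by apply/eqP => -[e]; move/eqP: ne; apply; apply/val_inj.
  by rewrite mul0r mulr0.
rewrite /routh_step /bump /= !add1n -/c.
case: (leqP j.+1 i.*2) => ji.
  have -> : (j.+1 < i.+1.*2)%N by lia.
  have -> : (j <= i.*2)%N by lia.
  have -> : odd (i.*2 - j.+1) by rewrite oddB // odd_double.
  have -> : odd (i.*2 - j) = false by rewrite oddB ?odd_double ?(negPf oj) //; lia.
  have -> : (i.+1.*2 - j.+2)%N = (i.*2 - j.+1).+1 by lia.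
  have -> : (i.*2 - j)%N = (i.*2 - j.+1).+1 by lia.
  by ring.
have jE := even_halfK oj.
case: (leqP j i.*2) => ji2; last first.
  have -> : (j.+1 < i.+1.*2)%N = false by lia.
  by rewrite mul0r addr0.
(* Boundary case j = 2i: the reduced matrix has a zero in column j + 1, and the entry p_0 comes
   entirely from the added column, as c p_1. *)
have -> : (j.+1 < i.+1.*2)%N by lia.
have -> : (i.*2 - j)%N = 0%N by lia.
have -> : (i.+1.*2 - j.+2)%N = 0%N by lia.
by rewrite /= add0r mulrC cE.
Qed.

Definition even_part p N w : R[i] := \sum_(s < N) (p s.*2)%:C%C * w ^+ s.*2.
Definition odd_part p N w : R[i] := \sum_(s < N) (p s.*2.+1)%:C%C * w ^+ s.*2.

Lemma even_part_routh_step p N w : even_part (routh_step p) N w = odd_part p N w.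
Proof. by apply: eq_bigr => s _; rewrite /routh_step odd_double. Qed.

(** The coefficients of E - c O are p_(2s) - c p_(2s+1). The one for s = 0 vanishes by the choice of
    c, so w^2 can be factored out. *)
Lemma even_part_rec p N w : p 1%N != 0 -> (forall k, (N.*2 <= k)%N -> p k = 0) ->
  even_part p N w = (p 0%N / p 1%N)%:C%C * odd_part p N w
                    + w ^+ 2 * odd_part (routh_step p) N w.
Proof.
move=> p1 pN; set c := p 0%N / p 1%N.
have cE : c * p 1%N = p 0%N by rewrite divfK.
apply/eqP; rewrite addrC -subr_eq; apply/eqP.
rewrite /even_part /odd_part !mulr_sumr -sumrB.
pose F s := (p s.*2 - c * p s.*2.+1)%:C%C * w ^+ s.*2.
transitivity (\sum_(s < N) F s).
  by apply: eq_bigr => s _; rewrite /F rmorphB mulrBl mulrA -rmorphM.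
(* A vanishing term is appended at the top, so that dropping the vanishing term s = 0 leaves N terms
   again after the shift. *)
transitivity (\sum_(s < N.+1) F s).
  rewrite big_ord_recr /= /F (pN _ (leqnn _)) (pN _ (leqnSn _)).
  by rewrite mulr0 subrr mul0r addr0.
rewrite big_ord_recl {1}/F /= cE subrr mul0r add0r; apply: eq_bigr => s _.
rewrite /F /= /bump /= add1n doubleS /routh_step /= odd_double /= -/c.
by rewrite !exprS; ring.
Qed.

(** Induction on the degree, with O' the odd part of the reduced polynomial, whose even part is O.
    From E = c O + w^2 O' follows Re (E conj(w O)) = c Re(w) |O|^2 + |w|^2 Re (O conj(w O')), and
    the last factor is the same quantity one degree lower. A common zero w <> 0 of E and w O is one
    of O and w O'; at w = 0 one has E = p_0 > 0. *)
Lemma hurwitz_positivity p m N w :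
  0 <= complex.Re w -> 0 < p m -> (m < N.*2)%N -> (forall k, (m < k)%N -> p k = 0) ->
  (forall k, (1 <= k <= m)%N -> 0 < \det (hurwitz_mx p k)) ->
  0 <= complex.Re (even_part p N w * (w * odd_part p N w)^*%C) /\
  ~ (even_part p N w = 0 /\ w * odd_part p N w = 0).
Proof.
move=> w_ge0; elim: m p => [|m IH] p pm mN psupp pdet.
  have -> : odd_part p N w = 0.
    by apply: big1 => s _; rewrite psupp // rmorph0 mul0r.
  rewrite mulr0 rmorph0 mulr0; split=> // -[+ _].
  case: N mN => // N _; rewrite /even_part big_ord_recl big1 => [|s _].
    by rewrite expr0 mulr1 addr0 => -[] p0; move: pm; rewrite p0 ltxx.
  by rewrite psupp // rmorph0 mul0r.
have p0 : 0 < p 0%N by rewrite -det_hurwitz_mx1; apply: pdet.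
(* In degree one p_1 is the leading coefficient; otherwise the second minor p_0 p_1 is available. *)
have p1 : 0 < p 1%N.
  case: m pm pdet {IH mN psupp} => [//|m] _ pdet.
  by have := pdet 2%N isT; rewrite det_hurwitz_mx2 pmulr_rgt0.
have p1n0 : p 1%N != 0 by rewrite gt_eqF.
have [] := IH (routh_step p).
- by rewrite /routh_step (psupp m.+2 (leqnn _)) mulr0 subr0 if_same.
- by lia.
- move=> k mk; rewrite /routh_step (psupp k.+1 mk) (psupp k.+2 (leqW mk)).
  by rewrite mulr0 subr0 if_same.
- move=> k /andP[k1 km]; have := pdet k.+1; rewrite det_hurwitz_step // pmulr_rgt0 //.
  by apply; lia.
rewrite even_part_routh_step.
have /= := even_part_rec w p1n0 _; set c := p 0%N / p 1%N.
have c0 : 0 <= c by rewrite divr_ge0 // ltW.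
move=> /(_ N) -> => [IH1 IH2|k Nk]; last by apply: psupp; lia.
split.
  set O1 := odd_part p N w; set O2 := odd_part (routh_step p) N w.
  rewrite -/O1 -/O2 in IH1.
  have -> : complex.Re ((c%:C%C * O1 + w ^+ 2 * O2) * (w * O1)^*%C) =
     c * complex.Re w * (complex.Re O1 ^+ 2 + complex.Im O1 ^+ 2)
     + (complex.Re w ^+ 2 + complex.Im w ^+ 2) * complex.Re (O1 * (w * O2)^*%C).
    by case: (w) (O1) (O2) => [? ?] [? ?] [? ?] /=; ring.
  by rewrite addr_ge0 // mulr_ge0 ?addr_ge0 ?sqr_ge0 // mulr_ge0.
move=> [EP OP]; case: (eqVneq w 0) => [w0|wn0].
  move: EP; rewrite -(even_part_rec w p1n0); last by move=> k Nk; apply: psupp; lia.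
  case: N mN {IH IH1 IH2 OP} => // N _; rewrite /even_part big_ord_recl big1 => [|s _].
    by rewrite expr0 mulr1 addr0 => -[] p00; move: p0; rewrite p00 ltxx.
  by rewrite w0 doubleS exprS mul0r mulr0.
move/eqP: OP; rewrite mulf_eq0 (negPf wn0) /= => /eqP O0.
move: EP; rewrite O0 mulr0 add0r => /eqP; rewrite expr2 -mulrA mulf_eq0 (negPf wn0) /=.
by move=> /eqP H; apply: IH2.
Qed.

(** At a root w O = - E, so the nonnegative quantity of [hurwitz_positivity] equals - |E|^2. Hence E
    and w O both vanish, which is excluded. *)
Theorem hurwitz_stable p m w :
  0 < p m -> (forall k, (m < k)%N -> p k = 0) ->
  (forall k, (1 <= k <= m)%N -> 0 < \det (hurwitz_mx p k)) ->
  \sum_(k < m.+1) (p k)%:C%C * w ^+ k = 0 -> complex.Re w < 0.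
Proof.
move=> pm psupp pdet root0; rewrite ltNge; apply/negP => w0.
have mN : (m < m.+1.*2)%N by lia.
have [pos nz] := hurwitz_positivity w0 pm mN psupp pdet.
set E := even_part _ _ _ in pos nz; set O := w * _ in pos nz.
have EO : E + O = 0.
  rewrite -root0 /E /O /even_part /odd_part mulr_sumr -big_split /=.
  have -> : \sum_(k < m.+1) (p k)%:C%C * w ^+ k = \sum_(k < m.+1.*2) (p k)%:C%C * w ^+ k.
    rewrite -!(big_mkord xpredT (fun k => (p k)%:C%C * w ^+ k)).
    rewrite (@big_cat_nat _ _ _ m.+1 0%N m.+1.*2) //=.
    rewrite [X in _ = _ + X]big_nat [X in _ = _ + X]big1 ?addr0 //.
    by move=> k /andP[mk _]; rewrite psupp // rmorph0 mul0r.
  elim: m.+1 => [|n IHn]; first by rewrite !big_ord0.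
  rewrite big_ord_recr doubleS !big_ord_recr /= IHn exprS; ring.
have OE : O = - E by apply/eqP; rewrite -addr_eq0 addrC EO.
move: pos; rewrite OE; case: (E) nz OE => [x y] nz OE /= pos.
have x0 : x = 0 by nra.
have y0 : y = 0 by nra.
by apply: nz; rewrite OE x0 y0 oppr0.
Qed.

End RouthHurwitz.

(** * Stability of the characteristic polynomial *)

Section HurwitzBridge.
Import Order.TTheory GRing.Theory Num.Theory.
Local Open Scope ring_scope.

(** The monic characteristic polynomial has coefficients - c_k and 1, so its Hurwitz matrix is the
    negative of the one built from [hurwitz_entry]; the factor (-1)^k accounts for this sign. *)
Lemma routh_hurwitz_stable m (c : nat -> R) (w : R[i]) :
  routh_hurwitz m c -> root (charpoly m c) w -> Rlt (complex.Re w) 0.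
Proof.
move=> RH root_w; apply/RltP.
pose p k := if (k < m)%N then - c k else (k == m)%:R : R.
have pm : p m = 1 by rewrite /p ltnn eqxx.
apply: (@hurwitz_stable _ p m).
- by rewrite pm.
- by move=> k mk; rewrite /p ltnNge ltnW //= gtn_eqF.
- move=> k km; have /RltP := RH k km.
  rewrite /hurwitz_det RmultE RpowE.
  suff -> : hurwitz_mx p k = - \matrix_(i < k, j < k) hurwitz_entry m c i j.
    by rewrite -scaleN1r detZ.
  apply/matrixP => i j; rewrite !mxE /hurwitz_entry /p -mul2n.
  case: (leqP j (2 * i)%N) => _; last exact: esym (@oppr0 R).

  case: (ltngtP (2 * i - j)%N m) => _; [by []|exact: esym (@oppr0 R)|exact: esym (@opprK R 1)].
- rewrite big_ord_recr /= pm mul1r addrC.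
  move: root_w; rewrite /charpoly rootE hornerD hornerN hornerXn horner_poly => /eqP H; apply: etrans H.
  congr (_ + _); rewrite -sumrN; apply: eq_bigr => k _.
  by rewrite /p ltn_ord rmorphN mulNr.
Qed.

Lemma routh_hurwitz_a0_lt0 m (c : nat -> R) :
  (1 <= m)%N -> routh_hurwitz m c -> Rlt (c 0%N) 0.
Proof.
move=> m1 RH; have := RH 1%N m1.
rewrite /hurwitz_det det_mx11 mxE /hurwitz_entry /= m1 /=.
by rewrite muln0 subn0; lra.
Qed.

End HurwitzBridge.

Local Open Scope R_scope.

(** * Calculus relative to an interval *)

(** The limit in [continue_in] leaves out the centre x itself; this form includes it, which
    composition and Lipschitz estimates rely on. *)
Lemma cont_onP (D : R -> Prop) (f : R -> R) :
  cont_on D f <->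
  forall x, D x -> forall e, 0 < e ->
    exists2 d, 0 < d & forall t, D t -> Rabs (t - x) < d -> Rabs (f t - f x) < e.
Proof.
split=> H x Dx e e0.
  have [d [d0 Hd]] := H x Dx e e0; exists d => // t Dt td.
  have [->|tx] := Req_dec t x; first by rewrite Rminus_diag Rabs_R0.
  by apply: Hd; split=> //; split=> //; exact: not_eq_sym.
have [d d0 Hd] := H x Dx e e0; exists d; split=> // t [[Dt _] td].
exact: Hd.
Qed.

Lemma cont_on_within (D : R -> Prop) (f : R -> R) :
  cont_on D f <->
  forall x, D x -> filterlim f (within D (locally x)) (locally (f x)).
Proof.
rewrite cont_onP; split=> H x Dx.
  apply/filterlim_locally => e; have [d d0 Hd] := H x Dx e (cond_pos e).
  by exists (mkposreal d d0) => t td Dt; apply: Hd.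
move=> e e0; have /filterlim_locally/(_ (mkposreal e e0))[d Hd] := H x Dx.
by exists d; [exact: cond_pos|move=> t Dt td; apply: Hd].
Qed.

Lemma cont_on_ext (D : R -> Prop) f g :
  (forall x, D x -> f x = g x) -> cont_on D f -> cont_on D g.
Proof.
move=> fg /cont_onP H; apply/cont_onP => x Dx e e0.
by have [d d0 Hd] := H x Dx e e0; exists d => // t Dt td; rewrite -!fg //; exact: Hd.
Qed.

Lemma cont_on_sub (D E : R -> Prop) f :
  (forall x, E x -> D x) -> cont_on D f -> cont_on E f.
Proof.
move=> ED /cont_onP H; apply/cont_onP => x Ex e e0.
have [d d0 Hd] := H x (ED x Ex) e e0; exists d => // t Et; apply: Hd; exact: ED.
Qed.

Lemma cont_on_const (D : R -> Prop) k : cont_on D (fun=> k).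
Proof. by apply/cont_on_within => x _; apply: filterlim_const. Qed.

Lemma cont_on_plus (D : R -> Prop) f g :
  cont_on D f -> cont_on D g -> cont_on D (fun x => f x + g x).
Proof.
move=> /cont_on_within cf /cont_on_within cg; apply/cont_on_within => x Dx.
by apply: filterlim_comp_2 (cf x Dx) (cg x Dx) _; exact: (filterlim_plus (f x) (g x)).
Qed.

Lemma cont_on_mult (D : R -> Prop) f g :
  cont_on D f -> cont_on D g -> cont_on D (fun x => f x * g x).
Proof.
move=> /cont_on_within cf /cont_on_within cg; apply/cont_on_within => x Dx.
by apply: filterlim_comp_2 (cf x Dx) (cg x Dx) _; exact: (filterlim_mult (f x) (g x)).
Qed.

Lemma cont_on_scal (D : R -> Prop) k f : cont_on D f -> cont_on D (fun x => k * f x).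
Proof. by move=> cf; apply: cont_on_mult => //; exact: cont_on_const. Qed.

Lemma cont_on_opp (D : R -> Prop) f : cont_on D f -> cont_on D (fun x => - f x).
Proof.
by move=> cf; apply: cont_on_ext (cont_on_scal (-1) cf) => x _; ring.
Qed.

Lemma cont_on_minus (D : R -> Prop) f g :
  cont_on D f -> cont_on D g -> cont_on D (fun x => f x - g x).
Proof. by move=> cf cg; apply: cont_on_plus => //; exact: cont_on_opp. Qed.

Lemma cont_on_sum (D : R -> Prop) (f : nat -> R -> R) n :
  (forall k, (k <= n)%N -> cont_on D (f k)) ->
  cont_on D (fun x => sum_f_R0 (fun k => f k x) n).
Proof.
elim: n => [|n IH] cf /=; first exact: cf.
apply: cont_on_plus; last exact: cf.
by apply: IH => k kn; apply: cf; exact: leqW.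
Qed.

Lemma cont_on_comp (D E : R -> Prop) f g :
  (forall x, D x -> E (g x)) -> cont_on E f -> cont_on D g ->
  cont_on D (fun x => f (g x)).
Proof.
move=> DE /cont_onP cf /cont_onP cg; apply/cont_onP => x Dx e e0.
have [d d0 Hd] := cf _ (DE x Dx) e e0; have [d' d'0 Hd'] := cg x Dx d d0.
by exists d' => // t Dt td; apply: Hd; [exact: DE|exact: Hd'].
Qed.

Lemma cont_on_continuous (D : R -> Prop) f :
  (forall x, D x -> continuous f x) -> cont_on D f.
Proof.
move=> cf; apply/cont_on_within => x Dx; apply: filterlim_filter_le_1 (cf x Dx).
exact: filter_le_within.
Qed.

Lemma cont_on_Rinv (D : R -> Prop) f :
  (forall x, D x -> f x <> 0) -> cont_on D f -> cont_on D (fun x => / f x).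
Proof.
move=> f0 cf; apply: (@cont_on_comp D (fun y => y <> 0) Rinv f) => //.
by apply: cont_on_continuous => x x0; apply: continuous_Rinv.
Qed.

Lemma deriv_on_cont (D : R -> Prop) f df : deriv_on D f df -> cont_on D f.
Proof. by move=> H x Dx; apply: cont_deriv (H x Dx). Qed.

Lemma D_in_is_derive (D : R -> Prop) f df x :
  locally x D -> D_in f df D x -> is_derive f x (df x).
Proof.
move=> [r Hr] H; apply/is_derive_Reals => e e0.
have [d [d0 Hd]] := H e e0.
have s0 : 0 < Rmin d r by apply: Rmin_pos => //; exact: cond_pos.
exists (mkposreal _ s0) => h h0 /= hs.
have hd : Rabs h < d by apply: Rlt_le_trans hs (Rmin_l _ _).
have hr : Rabs h < r by apply: Rlt_le_trans hs (Rmin_r _ _).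
have := Hd (x + h); rewrite /= /R_dist.
have -> : x + h - x = h by ring.
apply; split=> //; split; last by lra.
by apply: Hr; change (Rabs (x + h - x) < r); have -> : x + h - x = h by ring.
Qed.

Lemma locally_Icc u v x : u < x < v -> locally x (Icc u v).
Proof.
move=> ux; have r0 : 0 < Rmin (x - u) (v - x) by apply: Rmin_pos; lra.
exists (mkposreal _ r0) => t tx; have {tx} : Rabs (t - x) < Rmin (x - u) (v - x) by [].
have := Rmin_l (x - u) (v - x); have := Rmin_r (x - u) (v - x).
by move=> ? ? /Rabs_def2[? ?]; rewrite /Icc; lra.
Qed.

Lemma deriv_on_is_derive u v f df x :
  deriv_on (Icc u v) f df -> u < x < v -> is_derive f x (df x).
Proof.
move=> H ux; apply: D_in_is_derive (locally_Icc ux) _; apply: H; rewrite /Icc; lra.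
Qed.

(** Composing with this projection extends a function continuous on [u,v] to a continuous function
    on the line, so that theorems requiring two-sided continuity apply up to the end points. *)
Definition clamp u v x := Rmax u (Rmin v x).

Lemma clamp_in u v x : u <= v -> Icc u v (clamp u v x).
Proof. by move=> uv; rewrite /clamp /Icc /Rmax /Rmin; case: (Rle_dec v x) => ?; case: Rle_dec => ?; lra. Qed.

Lemma clamp_id u v x : Icc u v x -> clamp u v x = x.
Proof. by rewrite /clamp /Icc /Rmax /Rmin; case: (Rle_dec v x) => ?; case: Rle_dec => ?; lra. Qed.

Lemma clamp_lip u v x t : Rabs (clamp u v t - clamp u v x) <= Rabs (t - x).
Proof.
rewrite /clamp /Rmax /Rmin; case: (Rle_dec v t) => ?; case: (Rle_dec v x) => ?;
  repeat (case: Rle_dec => ?); split_Rabs; lra.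
Qed.

Lemma continuous_clamp u v f x :
  u <= v -> cont_on (Icc u v) f -> continuous (fun t => f (clamp u v t)) x.
Proof.
move=> uv /cont_onP cf; apply/filterlim_locally => e.
have [d d0 Hd] := cf _ (clamp_in x uv) e (cond_pos e).
exists (mkposreal d d0) => t td; apply: (Hd (clamp u v t)); first exact: clamp_in.
exact: Rle_lt_trans (clamp_lip _ _ _ _) td.
Qed.

Lemma cont_on_bounded u v f : u <= v -> cont_on (Icc u v) f ->
  exists M, forall x, Icc u v x -> Rabs (f x) <= M.
Proof.
move=> uv cf.
have cc c : u <= c <= v -> continuity_pt (fun t => Rabs (f (clamp u v t))) c.
  move=> _; apply/continuity_pt_filterlim.
  by apply: continuous_comp; [exact: continuous_clamp|exact: continuous_Rabs].
have [M [HM _]] := continuity_ab_maj _ _ _ uv cc.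
by exists (Rabs (f (clamp u v M))) => x xI; have := HM x xI; rewrite (clamp_id xI).
Qed.

Lemma ex_RInt_Icc u v f : u <= v -> cont_on (Icc u v) f -> ex_RInt f u v.
Proof.
move=> uv cf; apply: (ex_RInt_ext (fun t => f (clamp u v t))).
  by rewrite Rmin_left ?Rmax_right // => x ux; rewrite clamp_id // /Icc; lra.
by apply: ex_RInt_continuous => x _; exact: continuous_clamp.
Qed.

(** The derivative is required only inside the interval, as y has its m-th derivative only on (0,X].
    The extended F minus the integral of the extended f has derivative 0 inside, hence equal values
    at u and v. *)
Lemma is_RInt_derive_Icc u v F f : u <= v -> cont_on (Icc u v) F ->
  (forall x, u < x < v -> is_derive F x (f x)) -> cont_on (Icc u v) f ->
  is_RInt f u v (F v - F u).
Proof.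
move=> uv cF dF cf; set fc := fun t => f (clamp u v t).
have cfc x : continuous fc x by exact: continuous_clamp.
have dG x : is_derive (RInt fc u) x (fc x).
  apply: is_derive_RInt (cfc x); exists (mkposreal 1 Rlt_0_1) => t _.
  by apply: RInt_correct; apply: ex_RInt_continuous.
pose H t := F (clamp u v t) - RInt fc u t.
have [c [_]] : exists c, Rmin u v <= c <= Rmax u v /\ H v - H u = 0 * (v - u).
  apply: (MVT_gen H u v (fun=> 0)) => x; rewrite Rmin_left ?Rmax_right // => ux.
    have -> : 0 = f x - fc x by rewrite /fc clamp_id /Icc; lra.
    apply: is_derive_minus => //.
    apply: is_derive_ext_loc (dF x ux).
    by apply: filter_imp (locally_Icc ux) => t tI; rewrite clamp_id.
  apply/continuity_pt_filterlim; apply: continuous_minus.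
    exact: continuous_clamp.
  by apply: ex_derive_continuous; exists (fc x).
rewrite /H RInt_point /zero /= !clamp_id; [|by rewrite /Icc; lra..] => E.
have -> : F v - F u = RInt fc u v by lra.
apply: (is_RInt_ext fc); last by apply: RInt_correct; apply: ex_RInt_continuous.
by rewrite Rmin_left ?Rmax_right // => x ux; rewrite /fc clamp_id // /Icc; lra.
Qed.

Lemma Rabs_RInt_le u v f g l : u <= v -> ex_RInt f u v ->
  (forall x, u <= x <= v -> Rabs (f x) <= g x) -> is_RInt g u v l ->
  Rabs (RInt f u v) <= l.
Proof.
move=> uv ef fg ig; have := norm_RInt_le f g u v _ l uv _ (RInt_correct _ _ _ ef) ig.
by apply.
Qed.

Lemma mean_value_Icc u v f df M : cont_on (Icc u v) f ->
  (forall x, u < x < v -> is_derive f x (df x)) ->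
  (forall x, u < x < v -> Rabs (df x) <= M) -> 0 <= M ->
  forall s t, Icc u v s -> Icc u v t -> Rabs (f s - f t) <= M * Rabs (s - t).
Proof.
move=> cf dfP dM M0.
suff wlog s t : Icc u v s -> Icc u v t -> t <= s -> Rabs (f s - f t) <= M * Rabs (s - t).
  move=> s t sI tI; have [|ts] := Rle_dec t s; first exact: wlog.
  by rewrite Rabs_minus_sym (Rabs_minus_sym s); apply: wlog => //; lra.
move=> sI tI ts; have uv : u <= v by move: sI tI; rewrite /Icc; lra.
have [->|nst] := Req_dec s t; first by rewrite !Rminus_diag Rabs_R0; lra.
pose g x := f (clamp u v x).
(* The intermediate point of [MVT_gen] may be an end point, where [df] is not controlled; the value
   0 there keeps the bound M. *)
pose dg x := if Rlt_dec u x then if Rlt_dec x v then df x else 0 else 0.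
have dgM x : Rabs (dg x) <= M.
  rewrite /dg; case: Rlt_dec => [ux|?] /=; last by rewrite Rabs_R0.
  by case: Rlt_dec => [xv|?] /=; [exact: dM|rewrite Rabs_R0].
have [c [_ E]] : exists c, Rmin t s <= c <= Rmax t s /\ g s - g t = dg c * (s - t).
  apply: (MVT_gen g t s dg) => x; rewrite Rmin_left ?Rmax_right // => tx.
    have ux : u < x < v by move: sI tI; rewrite /Icc; lra.
    rewrite /dg; case: Rlt_dec => [?|] /=; last by lra.
    case: Rlt_dec => [?|] /=; last by lra.
    apply: is_derive_ext_loc (dfP x ux).
    by apply: filter_imp (locally_Icc ux) => y yI; rewrite /g clamp_id.
  by apply/continuity_pt_filterlim; apply: continuous_clamp.
move: E; rewrite /g !clamp_id // => ->; rewrite Rabs_mult.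
by apply: Rmult_le_compat_r (dgM c); exact: Rabs_pos.
Qed.

(** * Linear equations with constant coefficients *)

Lemma eq_sum_f_R0 (f g : nat -> R) n :
  (forall k, (k <= n)%N -> f k = g k) -> sum_f_R0 f n = sum_f_R0 g n.
Proof. by move=> fg; apply: PartSum.sum_eq => k /leP; exact: fg. Qed.

Lemma le_sum_f_R0 (f g : nat -> R) n :
  (forall k, (k <= n)%N -> f k <= g k) -> sum_f_R0 f n <= sum_f_R0 g n.
Proof. by move=> fg; apply: sum_Rle => k /leP; exact: fg. Qed.

Lemma sum_f_R0_ge0 (f : nat -> R) n :
  (forall k, (k <= n)%N -> 0 <= f k) -> 0 <= sum_f_R0 f n.
Proof.
move=> f0; apply: Rle_trans (le_sum_f_R0 f0); rewrite sum_cte; lra.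
Qed.

Lemma term_le_sum_f_R0 (f : nat -> R) n k :
  (forall k, (k <= n)%N -> 0 <= f k) -> (k <= n)%N -> f k <= sum_f_R0 f n.
Proof.
elim: n => [|n IH] f0; first by rewrite leqn0 => /eqP ->; right.
have f0' l : (l <= n)%N -> 0 <= f l by move=> ln; apply: f0; exact: leqW.
rewrite leq_eqVlt => /orP[/eqP -> /=|kn /=].
  by have := sum_f_R0_ge0 f0'; lra.
by have := f0 n.+1 (leqnn _); have := IH f0' kn; lra.
Qed.

Lemma Rabs_sum_f_R0_le (f g : nat -> R) n :
  (forall k, (k <= n)%N -> Rabs (f k) <= g k) ->
  Rabs (sum_f_R0 f n) <= sum_f_R0 g n.
Proof.
move=> fg; apply: Rle_trans (Rsum_abs _ _) _; exact: le_sum_f_R0.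
Qed.

Lemma sum_f_R0_delta (f : nat -> R) n j : (j <= n)%N ->
  sum_f_R0 (fun k => f k * (if k == j then 1 else 0)) n = f j.
Proof.
elim: n => [|n IH]; first by rewrite leqn0 => /eqP -> /=; ring.
rewrite leq_eqVlt => /orP[/eqP ->|jn] /=.
  rewrite eqxx -[RHS]Rplus_0_l Rmult_1_r; congr (_ + _).
  rewrite (@eq_sum_f_R0 _ (fun=> 0)); first by rewrite sum_cte; ring.
  by move=> k kn; rewrite ltn_eqF ?ltnS //; ring.
by rewrite IH // gtn_eqF //; ring.
Qed.

Lemma is_derive_sum_f_R0 (f df : nat -> R -> R) n t :
  (forall k, (k <= n)%N -> is_derive (f k) t (df k t)) ->
  is_derive (fun s => sum_f_R0 (fun k => f k s) n) t
            (sum_f_R0 (fun k => df k t) n).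
Proof.
elim: n => [|n IH] H /=; first exact: H.
apply: (is_derive_plus (fun s => sum_f_R0 (fun k => f k s) n) (f n.+1)); last exact: H.
by apply: IH => k kn; apply: H; exact: leqW.
Qed.

Lemma is_derive_eq (f : R -> R) x l l' : is_derive f x l -> l = l' -> is_derive f x l'.
Proof. by move=> H <-. Qed.

Lemma is_derive_Rmult (f g : R -> R) x df dg : is_derive f x df -> is_derive g x dg ->
  is_derive (fun t => f t * g t) x (df * g x + f x * dg).
Proof. by move=> Hf Hg; apply: (is_derive_mult f g) => //; exact: Rmult_comm. Qed.

(** The order is n + 1, so that m = n + 1 turns the summation bound [m.-1] into n. *)
Definition const_ode_sol n (c : nat -> R) (u : nat -> R -> R) : Prop :=
  (forall k t, (k <= n)%N -> is_derive (u k) t (u k.+1 t)) /\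
  (forall t, u n.+1 t = sum_f_R0 (fun k => c k * u k t) n).

Lemma lin_ode_sol_const n c u :
  lin_ode_sol (fun=> True) n.+1 c u -> const_ode_sol n c u.
Proof.
move=> [H1 H2]; split=> [k t kn|t]; last exact: H2.
by apply: (D_in_is_derive (D := fun=> True)); [exact: filter_true|exact: H1].
Qed.

Lemma const_ode_sol_sub n c u v x : const_ode_sol n c u -> const_ode_sol n c v ->
  const_ode_sol n c (fun k t => u k t - x * v k t).
Proof.
move=> [du eu] [dv ev]; split=> [k t kn|t].
  apply: (is_derive_minus (u k) (fun s => x * v k s)); first exact: du.
  by apply: is_derive_scal; exact: dv.
rewrite eu ev scal_sum -minus_sum; apply: eq_sum_f_R0 => k _; ring.
Qed.

(** The derivative of a solution, with its successive derivatives. Nothing is known of [u] beyond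
    index n + 1, so the last entry is the differentiated equation. *)
Definition ode_shift n (c : nat -> R) (u : nat -> R -> R) k t : R :=
  if (k <= n)%N then u k.+1 t else sum_f_R0 (fun l => c l * u l.+1 t) n.

Lemma const_ode_sol_shift n c u :
  const_ode_sol n c u -> const_ode_sol n c (ode_shift n c u).
Proof.
move=> [du eu]; split=> [k t kn|t].
  rewrite /ode_shift kn; move: kn; rewrite leq_eqVlt => /orP[/eqP ->|kn].
    rewrite ltnn; apply: is_derive_ext (fun s => esym (eu s)) _.
    apply: (@is_derive_sum_f_R0 (fun l s => c l * u l s) (fun l s => c l * u l.+1 s)) => l ln.
    by apply: is_derive_scal; exact: du.
  by rewrite kn; exact: du.
rewrite /ode_shift ltnn; apply: eq_sum_f_R0 => k kn; by rewrite kn.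
Qed.

(** S(t) exp(- K t) is nonincreasing, starts at 0 and is nonnegative. *)
Lemma Gronwall_zero (S dS : R -> R) K : (forall t, 0 <= t -> is_derive S t (dS t)) ->
  (forall t, 0 <= t -> dS t <= K * S t) -> (forall t, 0 <= S t) -> S 0 = 0 ->
  forall t, 0 <= t -> S t = 0.
Proof.
move=> dSP dSK Sge0 S0 t t0; have [->//|tn0] := Req_dec t 0.
pose W s := S s * exp (- K * s); pose dW s := (dS s - K * S s) * exp (- K * s).
have dWP s : 0 <= s -> is_derive W s (dW s).
  move=> s0; have -> : dW s = dS s * exp (- K * s) + S s * (- K * exp (- K * s)).
    by rewrite /dW; ring.
  apply: (is_derive_Rmult (g := fun s => exp (- K * s))) (dSP s s0) _.
  by auto_derive => //; ring.
have [c [c0 [ct E]]] : exists c, 0 <= c /\ c <= t /\ W t = W 0 + dW c * (t - 0).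
  apply: MVT_cor3; first lra.
  by move=> x x0 _; apply/is_derive_Reals; exact: dWP.
have dWc : dW c <= 0.
  have := dSK c c0; have := exp_pos (- K * c); rewrite /dW => e1 e2; nra.
have Wt : S t * exp (- K * t) <= 0 by move: E; rewrite {1 2}/W S0; nra.
by have := Sge0 t; have := exp_pos (- K * t); nra.
Qed.

(** Energy method: the sum S of the squares of u, ..., u^(n) satisfies S' <= K S, since each product
    of two derivatives is at most S and u^(n+1) is a combination of the lower ones. *)
Lemma const_ode_sol_zero n c u : const_ode_sol n c u ->
  (forall k, (k <= n)%N -> u k 0 = 0) ->
  forall k t, (k <= n)%N -> 0 <= t -> u k t = 0.
Proof.
move=> [du eu] u0.
pose S t := sum_f_R0 (fun k => u k t ^ 2) n.
pose dS t := sum_f_R0 (fun k => 2 * u k t * u k.+1 t) n.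
pose A := sum_f_R0 (fun l => Rabs (c l)) n.
have A0 : 0 <= A by apply: sum_f_R0_ge0 => k _; exact: Rabs_pos.
have S0 t : 0 <= S t by apply: sum_f_R0_ge0 => k _; exact: pow2_ge_0.
have leS k t : (k <= n)%N -> u k t ^ 2 <= S t.
  by apply: (@term_le_sum_f_R0 (fun k => u k t ^ 2)) => l _; exact: pow2_ge_0.
have dSP t : is_derive S t (dS t).
  apply: (@is_derive_sum_f_R0 (fun k t => u k t ^ 2) (fun k t => 2 * u k t * u k.+1 t)).
  move=> k kn; apply: (is_derive_eq (is_derive_pow (u k) 2 t _ (du k t kn))).
  by rewrite /=; ring.
have cross k l t : (k <= n)%N -> (l <= n)%N -> Rabs (2 * u k t * u l t) <= 2 * S t.
  move=> kn ln; have := leS k t kn; have := leS l t ln => H1 H2.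
  apply: Rabs_le; nra.
have dSK t : dS t <= sum_f_R0 (fun=> 2 + 2 * A) n * S t.
  have AS := Rmult_le_pos _ _ A0 (S0 t).
  rewrite Rmult_comm scal_sum; apply: le_sum_f_R0 => k kn.
  have [ltkn|] := ltnP k n.
    have := cross k k.+1 t kn ltkn; move=> /Rabs_le_between[_ H]; have := S0 t; nra.
  move=> nk; have -> : k = n by apply/eqP; rewrite eqn_leq kn.
  rewrite eu scal_sum.
  have : Rabs (sum_f_R0 (fun i => c i * u i t * (2 * u n t)) n)
     <= sum_f_R0 (fun i => Rabs (c i) * (2 * S t)) n.
    apply: Rabs_sum_f_R0_le => l ln.
    have -> : c l * u l t * (2 * u n t) = c l * (2 * u n t * u l t) by ring.
    by rewrite Rabs_mult; apply: Rmult_le_compat_l; [exact: Rabs_pos|exact: cross].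
  rewrite -(scal_sum (fun i => Rabs (c i))) -/A; move=> /Rabs_le_between[_ H]; have := S0 t; nra.
have Sz := Gronwall_zero (fun t _ => dSP t) (fun t _ => dSK t) S0 _.
move=> k t kn t0; have := leS k t kn; rewrite Sz //; first by have := pow2_ge_0 (u k t); nra.
rewrite /S (@eq_sum_f_R0 _ (fun=> 0)); first by rewrite sum_cte; ring.
by move=> l ln; rewrite u0 //; ring.
Qed.

Lemma const_ode_sol_unique n c u v : const_ode_sol n c u -> const_ode_sol n c v ->
  (forall k, (k <= n)%N -> u k 0 = v k 0) ->
  forall k t, (k <= n)%N -> 0 <= t -> u k t = v k t.
Proof.
move=> su sv uv0 k t kn t0.
have := const_ode_sol_zero (const_ode_sol_sub 1 su sv) _ kn t0.
by move=> H; apply: Rminus_diag_uniq; rewrite -[v k t]Rmult_1_l H // => l ln; rewrite uv0 //; ring.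
Qed.

(* [ode_basis n c phi j] is the solution whose [n - j]-th initial derivative
   is the only nonzero one, provided this holds of [phi] for [j = 0]. *)
Fixpoint ode_basis n (c : nat -> R) (phi : nat -> R -> R) j : nat -> R -> R :=
  if j is j'.+1 then
    fun k t => ode_shift n c (ode_basis n c phi j') k t - c (n - j')%N * phi k t
  else phi.

Lemma const_ode_sol_basis n c phi j :
  const_ode_sol n c phi -> const_ode_sol n c (ode_basis n c phi j).
Proof.
move=> sphi; elim: j => [//|j IH] /=.
by apply: const_ode_sol_sub => //; exact: const_ode_sol_shift.
Qed.

(** Differentiation moves the single initial 1 down by one index and creates the value c_(n-j) at
    index n; subtracting c_(n-j) phi removes it. For j = n + 1 all initial data are 0. *)
Lemma ode_basis_init n c phi j k :
  const_ode_sol n c phi ->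
  (forall k, (k <= n)%N -> phi k 0 = if k == n then 1 else 0) ->
  (j <= n.+1)%N -> (k <= n)%N ->
  ode_basis n c phi j k 0 = if (k + j == n)%N then 1 else 0.
Proof.
move=> sphi phi0; elim: j k => [|j IH] k jn kn; first by rewrite addn0; exact: phi0.
rewrite /= /ode_shift kn phi0 //; move: kn; rewrite leq_eqVlt => /orP[/eqP ->|kn].
  have [_ ->] := const_ode_sol_basis j sphi.
  rewrite eqxx; have -> : (n + j.+1 == n)%N = false.
    by rewrite -[X in _ == X]addn0 eqn_add2l.
  rewrite (@eq_sum_f_R0 _ (fun l => c l * (if l == (n - j)%N then 1 else 0))).
    by rewrite sum_f_R0_delta ?leq_subr //; ring.
  move=> l ln; rewrite IH //; last exact: leqW.
  by rewrite -(eqn_add2r j l) subnK.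
rewrite IH //; last exact: leqW.
by rewrite (ltn_eqF kn) addSnnS; ring.
Qed.

(** Q stands for the missing value after [zs n], that is, for the right-hand side of the last
    equation. *)
Lemma telescoping_chain n (zs e : nat -> R) Q N : (N <= n)%N ->
  sum_f_R0 (fun k => (if (k < n)%N then zs k.+1 else Q) * e (n - k)%N
                     - zs k * e (n - k).+1) N
  = (if (N < n)%N then zs N.+1 else Q) * e (n - N)%N - zs 0%N * e n.+1.
Proof.
elim: N => [|N IH] Nn /=; first by rewrite subn0.
rewrite IH ?(ltnW Nn) // Nn -subSn // subSS; ring.
Qed.

Lemma const_ode_sol_cont n c u k D :
  const_ode_sol n c u -> (k <= n)%N -> cont_on D (u k).
Proof.
move=> [du _] kn; apply: cont_on_continuous => x _.
by apply: ex_derive_continuous; exists (u k.+1 x); exact: du.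
Qed.

Lemma is_derive_reflect (f : R -> R) t s l :
  is_derive f (t - s) l -> is_derive (fun s => f (t - s)) s (- l).
Proof.
move=> df; have d : is_derive (fun s => t - s) s (-1) by auto_derive => //; ring.
apply: is_derive_eq (is_derive_comp f (fun s => t - s) s _ _ df d) _.
by rewrite /scal /= /mult /=; ring.
Qed.

Lemma cont_on_reflect (D : R -> Prop) t : cont_on D (fun s => t - s).
Proof.
apply: cont_on_continuous => x _; apply: ex_derive_continuous.
by exists (-1); auto_derive => //; ring.
Qed.

Lemma ode_basis_succ n c phi j i t : (i <= n)%N ->
  ode_basis n c phi j i.+1 t = ode_basis n c phi j.+1 i t + c (n - j)%N * phi i t.
Proof. by move=> /= ileqn; rewrite /ode_shift ileqn; ring. Qed.

(* The integrand is the derivative of [sum_k z_k(s) e_k(t - s)], where [e_k] is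
   the solution with [k]-th unit initial vector: by the equation for [z] and
   [ode_basis_succ], the homogeneous part of this derivative telescopes to 0. *)
Lemma variation_of_constants n c phi psi (z : nat -> R -> R) g1 gm T :
  const_ode_sol n c phi -> (forall k, (k <= n)%N -> phi k 0 = if k == n then 1 else 0) ->
  const_ode_sol n c psi -> (forall k, (k <= n)%N -> psi k 0 = if k == 0%N then 1 else 0) ->
  (forall k, (k <= n)%N -> cont_on (Icc 0 T) (z k)) ->
  cont_on (Icc 0 T) g1 -> cont_on (Icc 0 T) gm ->
  (forall k s, (k <= n)%N -> 0 < s < T -> is_derive (z k) s
     ((if (k < n)%N then z k.+1 s else sum_f_R0 (fun l => c l * z l s) n)
      + g1 s * (if k == 0%N then 1 else 0) + gm s * (if k == n then 1 else 0))) ->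
  (forall k, (k <= n)%N -> z k 0 = 0) ->
  forall i t, (i <= n)%N -> Icc 0 T t ->
  is_RInt (fun s => psi i (t - s) * g1 s + phi i (t - s) * gm s) 0 t (z i t).
Proof.
move=> sphi phi0 spsi psi0 cz cg1 cgm dz z0 i t ileqn [t0 tT].
pose e j := ode_basis n c phi j.
have se j : const_ode_sol n c (e j) by exact: const_ode_sol_basis.
have esucc j s : e j i.+1 s = e j.+1 i s + c (n - j)%N * phi i s by exact: ode_basis_succ.
have einit j k : (j <= n.+1)%N -> (k <= n)%N -> e j k 0 = if (k + j == n)%N then 1 else 0.
  exact: ode_basis_init.
have sub : forall x, Icc 0 t x -> Icc 0 T x by move=> x; rewrite /Icc; lra.
have cu u : const_ode_sol n c u -> cont_on (Icc 0 t) (fun s => u i (t - s)).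
  move=> su; apply: (cont_on_comp (E := fun=> True)) => //; last exact: cont_on_reflect.
  exact: const_ode_sol_cont su ileqn.
pose G s := sum_f_R0 (fun k => z k s * e (n - k)%N i (t - s)) n.
(* At s = t the kernels are at time 0, where the i-th derivative of [e (n - k)] is 1 for k = i and 0
   otherwise. *)
have Gt : G t = z i t.
  rewrite /G (@eq_sum_f_R0 _ (fun k => z k t * (if k == i then 1 else 0))).
    exact: sum_f_R0_delta.
  move=> k kn; rewrite Rminus_diag einit //; last by rewrite ltnW // ltnS leq_subr.
  by rewrite addnBA // -(eqn_add2r k) subnK ?(leq_trans kn) ?leq_addl // addnC eqn_add2l eq_sym.
have G0 : G 0 = 0.
  rewrite /G (@eq_sum_f_R0 _ (fun=> 0)); first by rewrite sum_cte; ring.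
  by move=> k kn; rewrite z0 //; ring.
have -> : z i t = G t - G 0 by rewrite Gt G0; ring.
apply: is_RInt_derive_Icc => //.
- apply: cont_on_sum => k kn; apply: cont_on_mult; first exact: cont_on_sub (cz k kn).
  exact: cu (se _).
- move=> s [s0 st]; have ts0 : 0 <= t - s by lra.
  have sT : 0 < s < T by lra.
  pose dzk k := (if (k < n)%N then z k.+1 s else sum_f_R0 (fun l => c l * z l s) n)
      + g1 s * (if k == 0%N then 1 else 0) + gm s * (if k == n then 1 else 0).
  have dG : is_derive G s (sum_f_R0 (fun k =>
      dzk k * e (n - k)%N i (t - s) + z k s * - e (n - k)%N i.+1 (t - s)) n).
    apply: (@is_derive_sum_f_R0 (fun k s => z k s * e (n - k)%N i (t - s))
      (fun k s' => dzk k * e (n - k)%N i (t - s) + z k s * - e (n - k)%N i.+1 (t - s))) => k kn.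
    apply: (is_derive_Rmult (g := fun s => e (n - k)%N i (t - s))) (dz k s kn sT) _.
    by apply: is_derive_reflect; have [+ _] := se (n - k)%N; apply.
  apply: is_derive_eq dG _.
  have en : e n i (t - s) = psi i (t - s).
    apply: const_ode_sol_unique (se n) spsi _ _ _ ileqn ts0 => k kn.
    by rewrite einit // psi0 // -[X in _ == X]add0n eqn_add2r.
  (* This kills the lower boundary term of the telescoping sum; the upper one cancels against the
     terms c_k phi. *)
  have en1 : e n.+1 i (t - s) = 0.
    apply: const_ode_sol_zero (se n.+1) _ _ _ ileqn ts0 => k kn.
    by rewrite einit // gtn_eqF // addnS ltnS leq_addl.
  have := telescoping_chain (fun k => z k s) (fun j => e j i (t - s))
    (sum_f_R0 (fun l => c l * z l s) n) (leqnn n).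
  rewrite ltnn subnn en1 Rmult_0_r Rminus_0_r /= => chain.
  set F := phi i (t - s) in chain *.
  have sg1 : sum_f_R0 (fun k => g1 s * e (n - k)%N i (t - s) * (if k == 0%N then 1 else 0)) n
     = g1 s * e n i (t - s) by rewrite sum_f_R0_delta // subn0.
  have sgm : sum_f_R0 (fun k => gm s * e (n - k)%N i (t - s) * (if k == n then 1 else 0)) n
     = gm s * F by rewrite sum_f_R0_delta // subnn.
  have sQ : sum_f_R0 (fun k => c k * z k s * F) n = F * sum_f_R0 (fun l => c l * z l s) n.
    by rewrite scal_sum.
  transitivity (sum_f_R0 (fun l => c l * z l s) n * F
     + (g1 s * e n i (t - s) + gm s * F - F * sum_f_R0 (fun l => c l * z l s) n)).
    rewrite -chain -sg1 -sgm -sQ -plus_sum -minus_sum -plus_sum.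
    apply: eq_sum_f_R0 => k kn; rewrite esucc subKn // /dzk -/F; ring.
  by rewrite en; ring.
- apply: cont_on_plus; apply: cont_on_mult; try exact: cu.
    exact: cont_on_sub cg1.
  exact: cont_on_sub cgm.
Qed.

(** The difference u' - u has zero initial data and solves the equation with coefficients c, forced
    in its last component by the sum of (c'_k - c_k) u'_k. *)
Lemma RInt_perturbation n c c' phi psi u u' :
  const_ode_sol n c phi -> (forall k, (k <= n)%N -> phi k 0 = if k == n then 1 else 0) ->
  const_ode_sol n c psi -> (forall k, (k <= n)%N -> psi k 0 = if k == 0%N then 1 else 0) ->
  const_ode_sol n c u -> const_ode_sol n c' u' ->
  (forall k, (k <= n)%N -> u k 0 = u' k 0) ->
  forall i t, (i <= n)%N -> 0 <= t ->
  is_RInt (fun s => phi i (t - s) * sum_f_R0 (fun k => (c' k - c k) * u' k s) n)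
    0 t (u' i t - u i t).
Proof.
move=> sphi phi0 spsi psi0 su su' u0 i t ileqn t0.
pose g s := sum_f_R0 (fun k => (c' k - c k) * u' k s) n.
have := @variation_of_constants n c phi psi (fun k s => u' k s - u k s) (fun=> 0) g t
  sphi phi0 spsi psi0 _ _ _ _ _ i t ileqn.
have cu : forall k, (k <= n)%N -> cont_on (Icc 0 t) (fun s => u' k s - u k s).
  by move=> k kn; apply: cont_on_minus; [exact: const_ode_sol_cont su' kn|exact: const_ode_sol_cont su kn].
have cg : cont_on (Icc 0 t) g.
  by apply: cont_on_sum => k kn; apply: cont_on_scal; exact: const_ode_sol_cont su' kn.
move=> /(_ cu (@cont_on_const _ _) cg) H.
apply: (is_RInt_ext (fun s => psi i (t - s) * 0 + phi i (t - s) * g s)).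
  by move=> s _; rewrite Rmult_0_r Rplus_0_l.
apply: H => [k s kn _|k kn|]; [|by rewrite u0 //; ring|by rewrite /Icc; lra].
move: (su) (su') => [du eu] [du' eu'].
apply: is_derive_eq (is_derive_minus _ _ _ _ _ (du' k s kn) (du k s kn)) _.
rewrite /minus /plus /= /Hierarchy.opp /=; move: kn; rewrite leq_eqVlt => /orP[/eqP ->|kn].
  rewrite ltnn eqxx eu eu' /g.
  have -> : sum_f_R0 (fun l => c l * (u' l s - u l s)) n =
    sum_f_R0 (fun k => c' k * u' k s) n - sum_f_R0 (fun k => c k * u k s) n
    - sum_f_R0 (fun k => (c' k - c k) * u' k s) n.
    by rewrite -!minus_sum; apply: eq_sum_f_R0 => k' _; ring.
  by ring.
by rewrite kn (ltn_eqF kn); ring.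
Qed.

(** * Exponential kernels *)

(** The integral of s^k exp(- chi s) over [0,t], in the recursive form given by integration by
    parts. *)
Fixpoint exp_moment (chi : R) k t : R :=
  if k is k'.+1 then (INR k'.+1 * exp_moment chi k' t - t ^ k'.+1 * exp (- chi * t)) / chi
  else (1 - exp (- chi * t)) / chi.

Lemma exp_neg_le1 chi t : 0 < chi -> 0 <= t -> exp (- chi * t) <= 1.
Proof.
move=> c0 t0; have [->|ct] := Req_dec t 0; first by rewrite Rmult_0_r exp_0; right.
by left; rewrite -exp_0; apply: exp_increasing; nra.
Qed.

Section ExpMoment.
Variable chi : R.
Hypothesis chi_gt0 : 0 < chi.

Lemma is_derive_exp_moment k t :
  is_derive (exp_moment chi k) t (t ^ k * exp (- chi * t)).
Proof.
elim: k t => [|k IH] t; first by rewrite /=; auto_derive => //; field; lra.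
have dp : is_derive (fun s => s ^ k.+1 * exp (- chi * s)) t
   (INR k.+1 * t ^ k * exp (- chi * t) + t ^ k.+1 * (- chi * exp (- chi * t))).
  apply: (is_derive_Rmult (f := fun s => s ^ k.+1) (g := fun s => exp (- chi * s))).
    by apply: is_derive_eq (is_derive_pow _ k.+1 _ _ (is_derive_id _)) _; rewrite Rmult_1_r.
  by auto_derive => //; ring.
have H := is_derive_scal _ _ (/ chi) _ (is_derive_minus _ _ _ _ _
  (is_derive_scal _ _ (INR k.+1) _ (IH t)) dp).
apply: is_derive_ext (is_derive_eq H _) => [s|].
  by rewrite /minus /plus /Hierarchy.opp [exp_moment _ _.+1 _]/= /Rdiv Rmult_comm.
rewrite /minus /plus /Hierarchy.opp /= -/(INR k.+1); field; lra.
Qed.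

Lemma exp_moment0 k : exp_moment chi k 0 = 0.
Proof.
elim: k => [|k IH] /=; first by rewrite Rmult_0_r exp_0; field; lra.
by rewrite IH; field; lra.
Qed.

Lemma exp_moment_ge0 k t : 0 <= t -> 0 <= exp_moment chi k t.
Proof.
move=> t0; have [->|tn0] := Req_dec t 0; first by rewrite exp_moment0; right.
have [c [c0 [ct ->]]] := MVT_cor3 (exp_moment chi k) (fun s => s ^ k * exp (- chi * s)) 0 t
  ltac:(lra) (fun x _ _ => proj1 (is_derive_Reals _ _ _) (is_derive_exp_moment k x)).
rewrite exp_moment0; have := pow_le c k c0; have := exp_pos (- chi * c) => e0 p0.
have := Rmult_le_pos _ _ p0 (Rlt_le _ _ e0); nra.
Qed.

Lemma exp_moment_le k t : 0 <= t -> exp_moment chi k t <= INR k`! / chi ^ k.+1.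
Proof.
move=> t0; elim: k => [|k IH].
  rewrite /= Rmult_1_r; apply: Rmult_le_compat_r; first by left; apply: Rinv_0_lt_compat.
  by have := exp_pos (- chi * t); lra.
have cK : 0 < chi ^ k.+1 by apply: pow_lt.
have -> : INR (k.+1)`! / chi ^ k.+2 = (INR k.+1 * (INR k`! / chi ^ k.+1)) / chi.
  by rewrite factS mult_INR -[chi ^ k.+2]/(chi * chi ^ k.+1); field; split; lra.
rewrite [exp_moment _ _ _]/= -/(INR k.+1).
apply: Rmult_le_compat_r; first by left; apply: Rinv_0_lt_compat.
have := Rmult_le_compat_l _ _ _ (pos_INR k.+1) IH.
have := pow_le t k.+1 t0; have := exp_pos (- chi * t) => e0 p0.
have := Rmult_le_pos _ _ p0 (Rlt_le _ _ e0); rewrite [t ^ k.+1]/=; lra.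
Qed.

Lemma pow_exp_le k t : 0 <= t -> t ^ k * exp (- chi * t) <= INR k`! / chi ^ k.
Proof.
move=> t0; case: k => [|k].
  rewrite /= Rmult_1_l Rdiv_1_r.
  exact: exp_neg_le1.
have := exp_moment_ge0 k.+1 t0; rewrite [exp_moment _ _ _]/= -/(INR k.+1) => H.
have H1 := exp_moment_le k t0.
have H2 := Rmult_le_compat_l _ _ _ (pos_INR k.+1) H1.
have cK : 0 < chi ^ k.+1 by apply: pow_lt.
have -> : INR (k.+1)`! / chi ^ k.+1 = INR k.+1 * (INR k`! / chi ^ k.+1).
  by rewrite factS mult_INR; field; lra.
apply: Rle_trans H2; have := Rmult_le_pos _ _ (Rlt_le _ _ chi_gt0) H.
by rewrite [t ^ k.+1]/=; move=> H3; field_simplify in H3; lra.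
Qed.

Lemma is_RInt_exp_moment k t :
  is_RInt (fun s => (t - s) ^ k * exp (- chi * (t - s))) 0 t (exp_moment chi k t).
Proof.
have -> : exp_moment chi k t = minus (- exp_moment chi k (t - t)) (- exp_moment chi k (t - 0)).
  by rewrite /minus /plus /Hierarchy.opp /= Rminus_diag Rminus_0_r exp_moment0; ring.
apply: (is_RInt_derive (fun s => - exp_moment chi k (t - s))) => x _.
  apply: is_derive_eq (is_derive_opp _ _ _ (is_derive_reflect (is_derive_exp_moment k (t - x)))) _.
  by rewrite /Hierarchy.opp /= Ropp_involutive.
apply: ex_derive_continuous; auto_derive => //.
Qed.

End ExpMoment.

Section Kernel.
Variables (chi C : R) (n : nat).
Hypotheses (chi_gt0 : 0 < chi) (C_ge0 : 0 <= C).

Lemma kernel_mass_le t : 0 <= t ->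
  exp_moment chi 0 t + exp_moment chi n t <= (chi ^ n + INR n`!) / chi ^ n.+1.
Proof.
move=> t0; have := exp_moment_le chi_gt0 0 t0; have := exp_moment_le chi_gt0 n t0.
have cn : 0 < chi ^ n by apply: pow_lt.
have -> : (chi ^ n + INR n`!) / chi ^ n.+1 = INR 0`! / chi ^ 1 + INR n`! / chi ^ n.+1.
  by rewrite /=; field; split; lra.
lra.
Qed.

Lemma kernel_first_moment_le t : 0 <= t ->
  exp_moment chi 1 t + exp_moment chi n.+1 t <= (chi ^ n + INR (n.+1)`!) / chi ^ n.+2.
Proof.
move=> t0; have := exp_moment_le chi_gt0 1 t0; have := exp_moment_le chi_gt0 n.+1 t0.
have cn : 0 < chi ^ n by apply: pow_lt.
have -> : (chi ^ n + INR (n.+1)`!) / chi ^ n.+2 = INR 1`! / chi ^ 2 + INR (n.+1)`! / chi ^ n.+2.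
  by rewrite [_ ^ n.+2]/= [_ ^ 2]/= [INR 1`!]/=; field; split; lra.
lra.
Qed.

Lemma RInt_kernel_le F M t : 0 <= t -> 0 <= M -> ex_RInt F 0 t ->
  (forall s, 0 <= s <= t ->
     Rabs (F s) <= C * (1 + (t - s) ^ n) * exp (- chi * (t - s)) * M) ->
  Rabs (RInt F 0 t) <= C * ((chi ^ n + INR n`!) / chi ^ n.+1) * M.
Proof.
move=> t0 M0 eF FM.
apply: Rle_trans (_ : C * M * (exp_moment chi 0 t + exp_moment chi n t) <= _); last first.
  have := Rmult_le_compat_l _ _ _ (Rmult_le_pos _ _ C_ge0 M0) (kernel_mass_le t0); lra.
apply: (Rabs_RInt_le t0 eF) (FM) _.
have H := is_RInt_scal _ _ _ (C * M) _ (is_RInt_plus _ _ _ _ _ _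
  (@is_RInt_exp_moment _ chi_gt0 0 t) (@is_RInt_exp_moment _ chi_gt0 n t)).
apply: is_RInt_ext H => s _; rewrite /scal /plus /= /mult /=; ring.
Qed.

Lemma RInt_kernel_weighted_le F M t : 0 <= t -> 0 <= M -> ex_RInt F 0 t ->
  (forall s, 0 <= s <= t ->
     Rabs (F s) <= C * (1 + (t - s) ^ n) * exp (- chi * (t - s)) * ((t - s) * M)) ->
  Rabs (RInt F 0 t) <= C * ((chi ^ n + INR (n.+1)`!) / chi ^ n.+2) * M.
Proof.
move=> t0 M0 eF FM.
apply: Rle_trans (_ : C * M * (exp_moment chi 1 t + exp_moment chi n.+1 t) <= _); last first.
  have := Rmult_le_compat_l _ _ _ (Rmult_le_pos _ _ C_ge0 M0) (kernel_first_moment_le t0); lra.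
apply: (Rabs_RInt_le t0 eF) (FM) _.
have H := is_RInt_scal _ _ _ (C * M) _ (is_RInt_plus _ _ _ _ _ _
  (@is_RInt_exp_moment _ chi_gt0 1 t) (@is_RInt_exp_moment _ chi_gt0 n.+1 t)).
apply: is_RInt_ext H => s _; rewrite /scal /plus /= /mult /=; ring.
Qed.

Lemma kernel_le s : 0 <= s ->
  C * (1 + s ^ n) * exp (- chi * s) <= C * (1 + INR n`! / chi ^ n).
Proof.
move=> s0; have := pow_exp_le chi_gt0 n s0; have := exp_neg_le1 chi_gt0 s0 => H1 H2.
have -> : C * (1 + s ^ n) * exp (- chi * s) = C * (exp (- chi * s) + s ^ n * exp (- chi * s)) by ring.
by apply: Rmult_le_compat_l => //; lra.
Qed.

End Kernel.

(** * Dependence of the fundamental solutions on the frozen point *)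

Section FrozenFamily.
Variables (n : nat) (X chi C : R) (a : nat -> R -> R) (N : nat -> R).
Variables (phi psi : R -> nat -> R -> R).
Hypotheses (chi_gt0 : 0 < chi) (C_ge0 : 0 <= C).
Hypothesis a_lip : forall k x x', (k <= n)%N -> Icc 0 X x -> Icc 0 X x' ->
  Rabs (a k x - a k x') <= N k * Rabs (x - x').
Hypothesis N_ge0 : forall k, (k <= n)%N -> 0 <= N k.
Hypothesis phi_def : is_Phim n.+1 X a phi.
Hypothesis psi_def : is_Phi1 n.+1 X a psi.
Hypothesis phi_le : Phi_bound n.+1 X phi chi C.
Hypothesis psi_le : Phi_bound n.+1 X psi chi C.

Let Lambda := sum_f_R0 N n.
Let B := C * (1 + INR n`! / chi ^ n).

(** By [RInt_perturbation] the difference is the integral of the decaying kernel [phi x] against a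
    source of size at most Lambda B |x' - x|. The kernel has bounded mass, so the bound does not
    grow with t. *)
Lemma frozen_lip (u : R -> nat -> R -> R) x x' :
  (forall x, Icc 0 X x -> const_ode_sol n (fun k => a k x) (u x)) ->
  (forall x x' k, Icc 0 X x -> Icc 0 X x' -> (k <= n)%N -> u x k 0 = u x' k 0) ->
  Phi_bound n.+1 X u chi C ->
  Icc 0 X x -> Icc 0 X x' ->
  forall i t, (i <= n)%N -> 0 <= t ->
  Rabs (u x' i t - u x i t) <=
    C * ((chi ^ n + INR n`!) / chi ^ n.+1) * (Lambda * B * Rabs (x' - x)).
Proof.
move=> su u0 ub xI x'I i t ileqn t0.
have [sphi phi0] := phi_def xI; have [spsi psi0] := psi_def xI.
have H := RInt_perturbation (lin_ode_sol_const sphi) phi0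
  (lin_ode_sol_const spsi) psi0 (su x xI) (su x' x'I) (fun k => u0 x x' k xI x'I) ileqn t0.
rewrite -(is_RInt_unique _ _ _ _ H).
have Bge0 : 0 <= B.
  apply: Rle_trans (kernel_le n chi_gt0 C_ge0 (Rle_refl 0)).
  exact: Rle_trans (Rabs_pos _) (phi_le (ltn0Sn n) (Rle_refl 0) xI).
have Lge0 : 0 <= Lambda by exact: sum_f_R0_ge0.
have dx := Rabs_pos (x' - x).
have nn := Rmult_le_pos _ _ (Rmult_le_pos _ _ Lge0 Bge0) dx.
apply: RInt_kernel_le => //; first by exists (u x' i t - u x i t).
move=> s [s0 st]; have ts0 : 0 <= t - s by lra.
rewrite Rabs_mult; apply: Rmult_le_compat => //; try exact: Rabs_pos.
  exact: phi_le.
have -> : Lambda * B * Rabs (x' - x) = sum_f_R0 (fun k => N k * (B * Rabs (x' - x))) n.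
  by rewrite -scal_sum -/Lambda; ring.
apply: Rabs_sum_f_R0_le => k kn; rewrite Rabs_mult.
have ukB : Rabs (u x' k s) <= B by apply: Rle_trans (ub k s x' kn s0 x'I) _; exact: kernel_le.
rewrite (_ : N k * (B * Rabs (x' - x)) = N k * Rabs (x' - x) * B); last by ring.
by apply: Rmult_le_compat; try exact: Rabs_pos; [exact: a_lip|].
Qed.

(* The constant [D] also bounds the functions, so that products stay Lipschitz. *)
Lemma frozen_family_lip (u : R -> nat -> R -> R) : 0 <= X ->
  (forall x, Icc 0 X x -> const_ode_sol n (fun k => a k x) (u x)) ->
  (forall x x' k, Icc 0 X x -> Icc 0 X x' -> (k <= n)%N -> u x k 0 = u x' k 0) ->
  Phi_bound n.+1 X u chi C ->
  exists2 D, 0 <= D & forall i x x' t t', (i <= n)%N -> Icc 0 X x -> Icc 0 X x' ->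
    0 <= t -> 0 <= t' ->
    Rabs (u x i t) <= D /\
    Rabs (u x i t - u x' i t') <= D * (Rabs (x - x') + Rabs (t - t')).
Proof.
move=> X0 su u0 ub.
have X00 : Icc 0 X 0 by rewrite /Icc; lra.
have uB i x t : (i <= n)%N -> Icc 0 X x -> 0 <= t -> Rabs (u x i t) <= B.
  by move=> ileqn xI t0; apply: Rle_trans (ub i t x ileqn t0 xI) _; exact: kernel_le.
have B0 : 0 <= B by exact: Rle_trans (Rabs_pos _) (uB 0%N 0 0 (leq0n n) X00 (Rle_refl 0)).
(* A bounds the sum of the |a_k(x)| over all x in [0,X]; it controls the derivative of order n + 1,
   which is known only through the equation. *)
pose A := sum_f_R0 (fun k => Rabs (a k 0) + N k * X) n.
have A0 : 0 <= A.
  apply: sum_f_R0_ge0 => k kn; have := Rabs_pos (a k 0); have := N_ge0 kn; nra.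
have aA k x : (k <= n)%N -> Icc 0 X x -> Rabs (a k x) <= Rabs (a k 0) + N k * X.
  move=> kn xI; have := a_lip kn xI X00; rewrite Rminus_0_r => H.
  have := Rabs_triang (a k 0) (a k x - a k 0).
  rewrite (_ : a k 0 + (a k x - a k 0) = a k x); last by ring.
  case: xI => x0 xX; move: H; rewrite (Rabs_pos_eq x) // => H.
  have := Rmult_le_compat_l _ _ _ (N_ge0 kn) xX; lra.
have dub i x t : (i <= n)%N -> Icc 0 X x -> 0 <= t -> Rabs (u x i.+1 t) <= (1 + A) * B.
  move=> ileqn xI t0; have [_ eu] := su x xI; have AB := Rmult_le_pos _ _ A0 B0.
  move: ileqn; rewrite leq_eqVlt => /orP[/eqP ->|ilt]; last first.
    by apply: Rle_trans (uB _ _ _ ilt xI t0) _; lra.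
  rewrite eu; apply: Rle_trans (_ : A * B <= _); last by lra.
  rewrite Rmult_comm scal_sum; apply: Rabs_sum_f_R0_le => k kn.
  by rewrite Rabs_mult; apply: Rmult_le_compat; try exact: Rabs_pos; [exact: aA|exact: uB].
have tlip i x t t' : (i <= n)%N -> Icc 0 X x -> 0 <= t -> 0 <= t' ->
    Rabs (u x i t - u x i t') <= (1 + A) * B * Rabs (t - t').
  move=> ileqn xI t0 t'0.
  apply: (@mean_value_Icc 0 (Rmax t t') _ (u x i.+1)).
  - exact: const_ode_sol_cont (su x xI) ileqn.
  - by move=> s _; have [du _] := su x xI; exact: du.
  - by move=> s s0; apply: dub => //; lra.
  - by have := Rmult_le_pos _ _ A0 B0; lra.
  - by have := Rmax_l t t'; rewrite /Icc; lra.
  - by have := Rmax_r t t'; rewrite /Icc; lra.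
pose D1 := C * ((chi ^ n + INR n`!) / chi ^ n.+1) * (Lambda * B).
have D1_ge0 : 0 <= D1.
  apply: Rmult_le_pos; last by apply: Rmult_le_pos => //; exact: sum_f_R0_ge0.
  (* At time 0 the moments vanish, so the moment bound itself yields nonnegativity of the
     constant. *)
  apply: Rmult_le_pos => //; apply: Rle_trans (kernel_mass_le n chi_gt0 (Rle_refl 0)).
  by rewrite !exp_moment0 //; lra.
have AB := Rmult_le_pos _ _ A0 B0.
exists (D1 + (1 + A) * B); first lra.
move=> i x x' t t' ileqn xI x'I t0 t'0; split.
  by apply: Rle_trans (uB _ _ _ ileqn xI t0) _; lra.
have H1 : Rabs (u x i t - u x' i t) <= D1 * Rabs (x - x').
  by rewrite /D1 Rmult_assoc; exact: (frozen_lip su u0 ub x'I xI ileqn t0).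
have H2 := tlip i x' t t' ileqn x'I t0 t'0.
have := Rabs_triang (u x i t - u x' i t) (u x' i t - u x' i t').
rewrite (_ : u x i t - u x' i t + (u x' i t - u x' i t') = u x i t - u x' i t'); last by ring.
have := Rabs_pos (x - x'); have := Rabs_pos (t - t') => p1 p2.
by move=> H3; nra.
Qed.

End FrozenFamily.

(** For x <= x' the increment splits into the integral over [0,x] of the change of the integrand and
    the integral over [x,x']; both are O(x' - x). Bounds are required only for s <= x, where the
    kernels are evaluated at nonnegative time. *)
Lemma RInt_param_cont (P S : R -> R -> R) T MP MS LP LS : 0 <= T ->
  (forall x, Icc 0 T x -> cont_on (Icc 0 x) (P x)) ->
  (forall x, Icc 0 T x -> cont_on (Icc 0 x) (S x)) ->
  (forall x s, Icc 0 T x -> Icc 0 x s -> Rabs (P x s) <= MP) ->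
  (forall x s, Icc 0 T x -> Icc 0 x s -> Rabs (S x s) <= MS) ->
  (forall x x' s, Icc 0 T x' -> Icc 0 x' x -> Icc 0 x s ->
     Rabs (P x' s - P x s) <= LP * (x' - x)) ->
  (forall x x' s, Icc 0 T x' -> Icc 0 x' x -> Icc 0 x s ->
     Rabs (S x' s - S x s) <= LS * (x' - x)) ->
  cont_on (Icc 0 T) (fun x => RInt (fun s => P x s * S x s) 0 x).
Proof.
move=> T0 cP cS bP bS lP lS.
pose w x := RInt (fun s => P x s * S x s) 0 x.
(* The signs of LP and LS are unknown; the absolute value makes K nonnegative. *)
pose K := T * Rabs (LP * MS + MP * LS) + MP * MS.
have T0I : Icc 0 T 0 by rewrite /Icc; lra.
have Z0I : Icc 0 0 0 by rewrite /Icc; lra.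
have MP0 : 0 <= MP := Rle_trans _ _ _ (Rabs_pos _) (bP 0 0 T0I Z0I).
have MS0 : 0 <= MS := Rle_trans _ _ _ (Rabs_pos _) (bS 0 0 T0I Z0I).
have lip x x' : Icc 0 T x' -> Icc 0 x' x -> Rabs (w x' - w x) <= K * (x' - x).
  move=> x'I xx'; have xI : Icc 0 T x by move: x'I xx'; rewrite /Icc; lra.
  have [[x'0 x'T] [x0 xx]] := (x'I, xx').
  have c' : cont_on (Icc 0 x') (fun s => P x' s * S x' s) by apply: cont_on_mult; auto.
  have c'1 : cont_on (Icc 0 x) (fun s => P x' s * S x' s).
    by apply: cont_on_sub c' => s; rewrite /Icc; lra.
  have c'2 : cont_on (Icc x x') (fun s => P x' s * S x' s).
    by apply: cont_on_sub c' => s; rewrite /Icc; lra.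
  have c : cont_on (Icc 0 x) (fun s => P x s * S x s) by apply: cont_on_mult; auto.
  have e'1 := ex_RInt_Icc x0 c'1; have e'2 := ex_RInt_Icc xx c'2; have e1 := ex_RInt_Icc x0 c.
  have -> : w x' - w x = RInt (fun s => P x' s * S x' s - P x s * S x s) 0 x
      + RInt (fun s => P x' s * S x' s) x x'.
    have E1 : RInt (fun s => P x' s * S x' s) 0 x + RInt (fun s => P x' s * S x' s) x x' = w x'.
      exact: RInt_Chasles e'1 e'2.
    have E2 : RInt (fun s => P x' s * S x' s - P x s * S x s) 0 x
       = RInt (fun s => P x' s * S x' s) 0 x - w x by exact: RInt_minus e'1 e1.
    by rewrite E2 -E1; lra.
  have I1 : Rabs (RInt (fun s => P x' s * S x' s - P x s * S x s) 0 x)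
      <= (x - 0) * ((LP * MS + MP * LS) * (x' - x)).
    apply: (Rabs_RInt_le x0 (g := fun=> (LP * MS + MP * LS) * (x' - x))).
    - exact: ex_RInt_minus e'1 e1.
    - move=> s sI.
      have s'I : Icc 0 x' s by move: sI; rewrite /Icc; lra.
      rewrite (_ : _ - _ = (P x' s - P x s) * S x' s + P x s * (S x' s - S x s)); last by ring.
      apply: Rle_trans (Rabs_triang _ _) _; rewrite !Rabs_mult.
      have h1 := Rmult_le_compat _ _ _ _ (Rabs_pos _) (Rabs_pos _) (lP x x' s x'I xx' sI) (bS x' s x'I s'I).
      have h2 := Rmult_le_compat _ _ _ _ (Rabs_pos _) (Rabs_pos _) (bP x s xI sI) (lS x x' s x'I xx' sI).
      by lra.
    - exact: is_RInt_const.
  have I2 : Rabs (RInt (fun s => P x' s * S x' s) x x') <= (x' - x) * (MP * MS).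
    apply: (Rabs_RInt_le xx (g := fun=> MP * MS)) => //; last exact: is_RInt_const.
    move=> s sI; have s'I : Icc 0 x' s by rewrite /Icc; lra.
    by rewrite Rabs_mult; apply: Rmult_le_compat; try exact: Rabs_pos; auto.
  have I3 : Rabs (RInt (fun s => P x' s * S x' s - P x s * S x s) 0 x)
      <= T * (Rabs (LP * MS + MP * LS) * (x' - x)).
    apply: Rle_trans I1 _; rewrite Rminus_0_r.
    have := Rle_abs (LP * MS + MP * LS); have := Rabs_pos (LP * MS + MP * LS) => q0 q1.
    have q2 : (LP * MS + MP * LS) * (x' - x) <= Rabs (LP * MS + MP * LS) * (x' - x).
      by apply: Rmult_le_compat_r; lra.
    have q3 : 0 <= Rabs (LP * MS + MP * LS) * (x' - x) by apply: Rmult_le_pos; lra.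
    nra.
  by apply: Rle_trans (Rabs_triang _ _) _; rewrite /K; lra.
have K0 : 0 <= K.
  apply: Rplus_le_le_0_compat; apply: Rmult_le_pos => //; exact: Rabs_pos.
have lipw x x' : Icc 0 T x -> Icc 0 T x' -> Rabs (w x' - w x) <= K * Rabs (x' - x).
  move=> xI x'I; have [xx|xx] := Rle_dec x x'.
    rewrite (Rabs_pos_eq (x' - x)); last by lra.
    by apply: lip => //; move: xI; rewrite /Icc; lra.
  rewrite Rabs_minus_sym (Rabs_minus_sym x') (Rabs_pos_eq (x - x')); last by lra.
  by apply: lip => //; move: x'I; rewrite /Icc; lra.
apply/cont_onP => x xI e e0; exists (e / (K + 1)); first by apply: Rdiv_lt_0_compat; lra.
move=> t tI tx; apply: Rle_lt_trans (lipw x t xI tI) _.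
have := Rabs_pos (t - x) => q0.
have : (K + 1) * Rabs (t - x) < (K + 1) * (e / (K + 1)) by apply: Rmult_lt_compat_l; lra.
rewrite (_ : (K + 1) * (e / (K + 1)) = e); [nra|field; lra].
Qed.

(** * Suprema and one-sided derivatives *)

(** [real] sends an infinite supremum to 0, so a finite bound M has to be exhibited. *)
Lemma le_real_Lub (E : R -> Prop) r M :
  E r -> (forall s, E s -> s <= M) -> r <= real (Lub_Rbar E).
Proof.
move=> Er EM; have [ub lub] := Lub_Rbar_correct E.
have := ub r Er; have : Rbar_le (Lub_Rbar E) (Rbar.Finite M) by apply: lub => s Es; exact: EM.
by case: (Lub_Rbar E).
Qed.

Lemma supnorm_le X g M :
  (forall x, Icc 0 X x -> Rabs (g x) <= M) -> Rbar_le (supnorm X g) (Rbar.Finite M).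
Proof.
move=> gM; have [_ lub] := Lub_Rbar_correct (fun r => exists x, Icc 0 X x /\ r = Rabs (g x)).
by apply: lub => r [x [xI ->]]; exact: gM.
Qed.

Lemma supnorm_vec_le m X g M :
  (forall i x, (1 <= i <= m)%N -> Icc 0 X x -> Rabs (g i x) <= M) ->
  Rbar_le (supnorm_vec m X g) (Rbar.Finite M).
Proof.
move=> gM; have [_ lub] := Lub_Rbar_correct (fun r => exists i x,
  (1 <= i <= m)%N /\ Icc 0 X x /\ r = Rabs (g i x)).
by apply: lub => r [i [x [im [xI ->]]]]; exact: gM.
Qed.

Lemma Rabs_le_supnorm X g x : 0 <= X -> cont_on (Icc 0 X) g -> Icc 0 X x ->
  Rabs (g x) <= real (supnorm X g).
Proof.
move=> X0 cg xI; have [M gM] := cont_on_bounded X0 cg.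
apply: (@le_real_Lub _ _ M); first by exists x.
by move=> s [t [tI ->]]; exact: gM.
Qed.

(** Limits within the interval, and with them one-sided derivatives, are unique because no point is
    isolated. At x = X the interval is approached from the left. *)
Lemma Icc_adherent X x : 0 < X -> Icc 0 X x -> adhDa (D_x (Icc 0 X) x) x.
Proof.
move=> X0 [x0 xX] e e0.
have [xlt|xge] := Rlt_dec x X.
  pose h := Rmin (e / 2) (X - x).
  have h0 : 0 < h by apply: Rmin_pos; lra.
  have := Rmin_l (e / 2) (X - x); have := Rmin_r (e / 2) (X - x); rewrite -/h => h1 h2.
  exists (x + h); split; first by split; [rewrite /Icc; lra|apply: Rlt_not_eq; lra].
  rewrite /= /R_dist; have -> : x + h - x = h by ring.
  by rewrite Rabs_pos_eq; lra.
pose h := Rmin (e / 2) X.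
have h0 : 0 < h by apply: Rmin_pos; lra.
have := Rmin_l (e / 2) X; have := Rmin_r (e / 2) X; rewrite -/h => h1 h2.
exists (x - h); split; first by split; [rewrite /Icc; lra|apply: Rgt_not_eq; lra].
rewrite /= /R_dist; have -> : x - h - x = - h by ring.
by rewrite Rabs_Ropp Rabs_pos_eq; lra.
Qed.

Lemma D_in_unique X f df dg x : 0 < X -> Icc 0 X x ->
  D_in f df (Icc 0 X) x -> D_in f dg (Icc 0 X) x -> df x = dg x.
Proof. by move=> X0 xI; apply: single_limit; exact: Icc_adherent. Qed.

(** [C1_on] provides some continuous derivative; uniqueness identifies it with the given one. *)
Lemma C1_on_deriv_cont X f df : 0 < X -> C1_on (Icc 0 X) f ->
  deriv_on (Icc 0 X) f df -> cont_on (Icc 0 X) df.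
Proof.
move=> X0 [dg [dgP cdg]] dfP; apply: cont_on_ext cdg => x xI.
exact: (D_in_unique X0 xI (dgP x xI) (dfP x xI)).
Qed.

Lemma D_in_ext (D : R -> Prop) f g df x : D x -> (forall t, D t -> f t = g t) ->
  D_in f df D x -> D_in g df D x.
Proof.
move=> Dx fg H e e0; have [d [d0 Hd]] := H e e0; exists d; split=> // t [[Dt xt] tx].
by rewrite -!fg //; apply: Hd.
Qed.

(* The derivative of a quotient is read off [f = (f / g) * g]. *)
Lemma quotient_deriv_cont X f g dq : 0 < X ->
  C1_on (Icc 0 X) f -> C1_on (Icc 0 X) g -> (forall x, Icc 0 X x -> g x <> 0) ->
  deriv_on (Icc 0 X) (fun x => f x / g x) dq -> cont_on (Icc 0 X) dq.
Proof.
move=> X0 [df [dfP cdf]] [dg [dgP cdg]] g0 dqP.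
have cg := deriv_on_cont dgP; have cq := deriv_on_cont dqP.
apply: (@cont_on_ext _ (fun x => (df x - f x / g x * dg x) * / g x)).
  move=> x xI; have H := Dmult _ _ _ _ _ _ (dqP x xI) (dgP x xI).
  have H' : D_in f (fun t => dq t * g t + f t / g t * dg t) (Icc 0 X) x.
    by apply: D_in_ext xI _ H => t tI; field; exact: g0.
  by rewrite (D_in_unique X0 xI (dfP x xI) H'); field; exact: g0.
apply: cont_on_mult; last exact: cont_on_Rinv.
by apply: cont_on_minus => //; apply: cont_on_mult.
Qed.

(** * The integral operator *)

Section Main.
Variables (n : nat) (X : R) (a da : nat -> R -> R) (b dybar : R -> R) (y0 : nat -> R).
Variables (Pi : nat -> R -> R) (Phi1 Phim : R -> nat -> R -> R).
Variables (chi CPhi Ct eps : R).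
Hypotheses (X_gt0 : 0 < X) (chi_gt0 : 0 < chi).
Hypothesis a_cont : forall k, (k <= n)%N -> cont_on (Icc 0 X) (a k).
Hypothesis a_deriv : forall k, (k <= n)%N -> deriv_on (Icc 0 X) (a k) (da k).
Hypothesis da_cont : forall k, (k <= n)%N -> cont_on (Icc 0 X) (da k).
Hypothesis a0_neq0 : forall x, Icc 0 X x -> a 0%N x <> 0.
Hypothesis ybar_deriv : deriv_on (Icc 0 X) (ybar a b) dybar.
Hypothesis dybar_cont : cont_on (Icc 0 X) dybar.
Hypothesis Pi_def : is_Pi n.+1 a b y0 Pi.
Hypothesis Phi1_def : is_Phi1 n.+1 X a Phi1.
Hypothesis Phim_def : is_Phim n.+1 X a Phim.
Hypothesis CPhi_gt0 : 0 < CPhi.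
Hypothesis Phi1_le : Phi_bound n.+1 X Phi1 chi CPhi.
Hypothesis Phim_le : Phi_bound n.+1 X Phim chi CPhi.
Hypothesis Pi_le : Pi_bound n.+1 Pi chi Ct.
Hypothesis eps_gt0 : 0 < eps.

Local Notation L := (X / eps).
Local Notation N k := (real (supnorm X (da k))).
Local Notation A := (Ahat n.+1 a dybar Pi Phi1 Phim eps).
Local Notation f := (fterm n.+1 a dybar Pi eps).
Local Notation al := (alpha n.+1 X da).
Local Notation Y := (real (supnorm X dybar)).

Lemma stretched_length_ge0 : 0 <= L.
Proof. by left; apply: Rdiv_lt_0_compat. Qed.

Lemma slow_variable xi : Icc 0 L xi -> Icc 0 X (eps * xi).
Proof.
move=> [x0 xL]; split; first by apply: Rmult_le_pos => //; lra.
rewrite (_ : X = eps * L); last by field; lra.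
by apply: Rmult_le_compat_l => //; lra.
Qed.

Lemma fast_variable x : Icc 0 X x -> Icc 0 L (x / eps).
Proof.
move=> [x0 xX]; split; first by apply: Rdiv_le_0_compat.
by apply: Rmult_le_compat_r => //; left; apply: Rinv_0_lt_compat.
Qed.

Lemma cont_slow g : cont_on (Icc 0 X) g -> cont_on (Icc 0 L) (fun s => g (eps * s)).
Proof.
move=> cg; apply: cont_on_comp (cg) _; first exact: slow_variable.
by apply: cont_on_scal; apply: cont_on_continuous => x _; exact: continuous_id.
Qed.

Lemma supnorm_da_ge0 k : (k <= n)%N -> 0 <= N k.
Proof.
move=> kn; have X0I : Icc 0 X 0 by rewrite /Icc; lra.
exact: Rle_trans (Rabs_pos _) (Rabs_le_supnorm (Rlt_le _ _ X_gt0) (da_cont kn) X0I).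
Qed.

Lemma supnorm_dybar_ge0 : 0 <= Y.
Proof.
have X0I : Icc 0 X 0 by rewrite /Icc; lra.
exact: Rle_trans (Rabs_pos _) (Rabs_le_supnorm (Rlt_le _ _ X_gt0) dybar_cont X0I).
Qed.

Lemma alpha_ge0 : 0 <= al.
Proof. by apply: sum_f_R0_ge0 => k; exact: supnorm_da_ge0. Qed.

Lemma alpha_mull K : al * K = sum_f_R0 (fun k => N k * K) n.
Proof. by rewrite /alpha Rmult_comm scal_sum. Qed.

Lemma a_lipschitz k x x' : (k <= n)%N -> Icc 0 X x -> Icc 0 X x' ->
  Rabs (a k x - a k x') <= N k * Rabs (x - x').
Proof.
move=> kn; apply: (mean_value_Icc (df := da k)) => //.
- exact: a_cont.
- by move=> t tX; exact: deriv_on_is_derive (a_deriv kn) tX.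
- move=> t tX; apply: Rabs_le_supnorm; [lra|exact: da_cont|rewrite /Icc; lra].
- exact: supnorm_da_ge0.
Qed.

Lemma Pi_cont k : (k <= n)%N -> cont_on (Icc 0 L) (Pi k).
Proof.
move=> kn; have [[dPi _] _] := Pi_def.
by apply: cont_on_sub (deriv_on_cont (dPi k kn)) => x [].
Qed.

Lemma fterm_cont : cont_on (Icc 0 L) f.
Proof.
apply: cont_on_minus.
  apply: cont_on_scal; apply: cont_on_sum => k kn.
  apply: cont_on_mult; last exact: Pi_cont.
  by apply: cont_on_minus; [apply: cont_slow; exact: a_cont|exact: cont_on_const].
by case: eqP => _; [exact: cont_slow|exact: cont_on_const].
Qed.

Lemma kernel_lip u : is_Phi1 n.+1 X a u \/ is_Phim n.+1 X a u -> Phi_bound n.+1 X u chi CPhi ->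
  exists2 D, 0 <= D & forall i x x' t t', (i <= n)%N -> Icc 0 X x -> Icc 0 X x' ->
    0 <= t -> 0 <= t' ->
    Rabs (u x i t) <= D /\
    Rabs (u x i t - u x' i t') <= D * (Rabs (x - x') + Rabs (t - t')).
Proof.
move=> udef ub; apply: (frozen_family_lip (N := fun k => N k) chi_gt0 (Rlt_le _ _ CPhi_gt0)
  a_lipschitz supnorm_da_ge0 Phim_def Phi1_def Phim_le) ub; first lra.
- by move=> x xI; apply: lin_ode_sol_const; case: udef => /(_ x xI)[].
- move=> x x' k xI x'I kn.
  by case: udef => H; have [_ H1] := H x xI; have [_ H2] := H x' x'I; rewrite H1 ?H2.
Qed.

Lemma kernel_cont u i xi : is_Phi1 n.+1 X a u \/ is_Phim n.+1 X a u ->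
  (i <= n)%N -> Icc 0 L xi -> cont_on (Icc 0 xi) (fun s => u (eps * xi) i (xi - s)).
Proof.
move=> udef ileqn xiI; apply: (cont_on_comp (E := fun=> True)) => //; last exact: cont_on_reflect.
apply: (@const_ode_sol_cont n (fun k => a k (eps * xi)) (u (eps * xi))) => //.
by apply: lin_ode_sol_const; case: udef => /(_ _ (slow_variable xiI))[].
Qed.

(* [xi] enters the kernel both as time and as frozen point, whence the factor [eps + 1]. *)
Lemma RInt_kernel_cont u i (S : R -> R -> R) MS LS :
  is_Phi1 n.+1 X a u \/ is_Phim n.+1 X a u -> Phi_bound n.+1 X u chi CPhi -> (i <= n)%N ->
  (forall x, Icc 0 L x -> cont_on (Icc 0 x) (S x)) ->
  (forall x s, Icc 0 L x -> Icc 0 x s -> Rabs (S x s) <= MS) ->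
  (forall x x' s, Icc 0 L x' -> Icc 0 x' x -> Icc 0 x s ->
     Rabs (S x' s - S x s) <= LS * (x' - x)) ->
  cont_on (Icc 0 L) (fun xi => RInt (fun s => u (eps * xi) i (xi - s) * S xi s) 0 xi).
Proof.
move=> udef ub ileqn cS bS lS; have [D D0 HD] := kernel_lip udef ub.
apply: (@RInt_param_cont (fun xi s => u (eps * xi) i (xi - s)) S L D MS (D * (eps + 1)) LS) => //.
- exact: stretched_length_ge0.
- by move=> x xI; exact: kernel_cont.
- move=> x s xI sI; have sx : 0 <= x - s by move: sI; rewrite /Icc; lra.
  by have [] := HD i _ _ _ _ ileqn (slow_variable xI) (slow_variable xI) sx sx.
- move=> x x' s x'I xI sI.
  have xI' : Icc 0 L x by move: x'I xI; rewrite /Icc; lra.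
  have sx : 0 <= x - s by move: sI; rewrite /Icc; lra.
  have sx' : 0 <= x' - s by move: xI sI; rewrite /Icc; lra.
  have [_] := HD i _ _ _ _ ileqn (slow_variable x'I) (slow_variable xI') sx' sx.
  have xx : 0 <= x' - x by move: xI; rewrite /Icc; lra.
  rewrite (_ : x' - s - (x - s) = x' - x); last by ring.
  rewrite -Rmult_minus_distr_l Rabs_mult (Rabs_pos_eq eps) ?(Rabs_pos_eq (x' - x)) //; lra.
Qed.

Definition source (z : nat -> R -> R) xi s : R :=
  sum_f_R0 (fun k => (a k (eps * s) - a k (eps * xi)) * z k.+1 s) n + f s.

Definition cont_components (z : nat -> R -> R) : Prop :=
  forall k, (k <= n)%N -> cont_on (Icc 0 L) (z k.+1).

Lemma Icc_trans t x s : Icc 0 t x -> Icc 0 x s -> Icc 0 t s.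
Proof. by rewrite /Icc; lra. Qed.

Lemma source_cont z xi : cont_components z -> Icc 0 L xi -> cont_on (Icc 0 xi) (source z xi).
Proof.
move=> cz xiI; have sub s : Icc 0 xi s -> Icc 0 L s := Icc_trans xiI (s := s).
apply: cont_on_plus; last exact: cont_on_sub fterm_cont.
apply: cont_on_sum => k kn; apply: cont_on_mult; last exact: cont_on_sub (cz k kn).
apply: cont_on_minus; last exact: cont_on_const.
by apply: cont_on_sub (cont_slow (a_cont kn)).
Qed.

Lemma cont_components_bounded z : cont_components z ->
  exists2 M, 0 <= M & forall k s, (k <= n)%N -> Icc 0 L s -> Rabs (z k.+1 s) <= M.
Proof.
rewrite /cont_components; elim: n => [|p IH] cz.
  have [M HM] := cont_on_bounded stretched_length_ge0 (cz 0%N isT).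
  exists (Rabs M) => [|k s]; first exact: Rabs_pos.
  by rewrite leqn0 => /eqP -> sI; apply: Rle_trans (HM s sI) (Rle_abs _).
have [M M0 HM] := IH (fun k kp => cz k (leqW kp)).
have [M' HM'] := cont_on_bounded stretched_length_ge0 (cz p.+1 (leqnn _)).
exists (Rmax M M') => [|k s]; first exact: Rle_trans M0 (Rmax_l _ _).
rewrite leq_eqVlt => /orP[/eqP ->|kp] sI.
  exact: Rle_trans (HM' s sI) (Rmax_r _ _).
exact: Rle_trans (HM k s kp sI) (Rmax_l _ _).
Qed.

Lemma coef_diff_le z M xi s : (forall k, (k <= n)%N -> Rabs (z k.+1 s) <= M) ->
  Icc 0 L xi -> Icc 0 L s ->
  Rabs (sum_f_R0 (fun k => (a k (eps * s) - a k (eps * xi)) * z k.+1 s) n)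
    <= al * (eps * Rabs (s - xi) * M).
Proof.
move=> zM xiI sI; rewrite alpha_mull; apply: Rabs_sum_f_R0_le => k kn.
rewrite Rabs_mult (_ : N k * (eps * Rabs (s - xi) * M) = N k * (eps * Rabs (s - xi)) * M); last by ring.
apply: Rmult_le_compat; try exact: Rabs_pos; last exact: zM.
have := a_lipschitz kn (slow_variable sI) (slow_variable xiI).
by rewrite -Rmult_minus_distr_l Rabs_mult (Rabs_pos_eq eps) //; lra.
Qed.

Lemma Ahat_cont z : cont_components z -> cont_components (A z).
Proof.
move=> cz i ileqn; have L0 := stretched_length_ge0.
apply: cont_on_plus.
  apply: cont_on_opp; case: (2 <= n.+1)%N; last exact: cont_on_const.
  apply: (@RInt_kernel_cont Phi1 i (fun _ s => dybar (eps * s)) Y 0); auto.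
  - move=> x xI; apply: cont_on_sub (cont_slow dybar_cont) => s; exact: Icc_trans.
  - move=> x s xI sI; apply: Rabs_le_supnorm => //; first lra.
    by apply: slow_variable; exact: Icc_trans sI.
  - by move=> x x' s _ _ _; rewrite Rminus_diag Rabs_R0; lra.
have [M M0 HM] := cont_components_bounded cz.
have [F HF] := cont_on_bounded L0 fterm_cont.
apply: (@RInt_kernel_cont Phim i (source z) (al * (eps * L * M) + F) (al * (eps * M))); auto.
- by move=> x xI; exact: source_cont.
- move=> x s xI sI; have sIL := Icc_trans xI sI.
  apply: Rle_trans (Rabs_triang _ _) _; apply: Rplus_le_compat; last exact: HF.
  apply: Rle_trans (coef_diff_le (fun k kn => HM k s kn sIL) xI sIL) _.
  apply: Rmult_le_compat_l; first exact: alpha_ge0.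
  apply: Rmult_le_compat_r => //; apply: Rmult_le_compat_l; first lra.
  by apply: Rabs_le; move: xI sI; rewrite /Icc; lra.
- move=> x x' s x'I xI sI; have xIL := Icc_trans x'I xI; have sIL := Icc_trans xIL sI.
  have xx : 0 <= x' - x by move: xI; rewrite /Icc; lra.
  rewrite /source (_ : forall p q r : R, p + r - (q + r) = p - q); last by move=> *; ring.
  rewrite -minus_sum Rmult_assoc alpha_mull; apply: Rabs_sum_f_R0_le => k kn.
  rewrite (_ : _ - _ = (a k (eps * x) - a k (eps * x')) * z k.+1 s); last by ring.
  rewrite Rabs_mult (_ : N k * _ = N k * (eps * (x' - x)) * M); last by ring.
  apply: Rmult_le_compat; try exact: Rabs_pos; last exact: HM.
  have := a_lipschitz kn (slow_variable xIL) (slow_variable x'I).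
  by rewrite -Rmult_minus_distr_l Rabs_mult (Rabs_pos_eq eps) ?(Rabs_minus_sym x) ?(Rabs_pos_eq (x' - x)); lra.
Qed.

Lemma phi_iter_cont p : cont_components (phi_iter n.+1 a dybar Pi Phi1 Phim eps p).
Proof.
elim: p => [|p IH] /=; first by move=> k kn; exact: cont_on_const.
exact: Ahat_cont.
Qed.

Lemma ex_RInt_source z i xi : cont_components z -> (i <= n)%N -> Icc 0 L xi ->
  ex_RInt (fun s => Phim (eps * xi) i (xi - s) * source z xi s) 0 xi.
Proof.
move=> cz ileqn xiI; apply: ex_RInt_Icc; first by case: xiI.
by apply: cont_on_mult; [apply: kernel_cont; auto|exact: source_cont].
Qed.

Lemma Ahat_contraction z z' M i xi : cont_components z -> cont_components z' ->
  (forall k s, (k <= n)%N -> Icc 0 L s -> Rabs (z k.+1 s - z' k.+1 s) <= M) ->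
  (i <= n)%N -> Icc 0 L xi ->
  Rabs (A z i.+1 xi - A z' i.+1 xi) <= eps * (CPhi * beta n.+1 X da chi) * M.
Proof.
move=> cz cz' zM ileqn xiI; have [xi0 xiL] := xiI.
have M0 : 0 <= M.
  have L0I : Icc 0 L 0 by have := stretched_length_ge0; rewrite /Icc; lra.
  exact: Rle_trans (Rabs_pos _) (zM 0%N 0 (leq0n _) L0I).
have e1 := ex_RInt_source cz ileqn xiI; have e2 := ex_RInt_source cz' ileqn xiI.
have -> : A z i.+1 xi - A z' i.+1 xi =
  RInt (fun s => Phim (eps * xi) i (xi - s) * source z xi s
                 - Phim (eps * xi) i (xi - s) * source z' xi s) 0 xi.
  rewrite [RHS](RInt_minus _ _ _ _ e1 e2) /minus /plus /Hierarchy.opp /= /Ahat /source /=; ring.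
(* The factor beta / alpha is the first moment of the kernel bound; the Phi^1 integral and f have
   cancelled in the difference. *)
have -> : eps * (CPhi * beta n.+1 X da chi) * M =
  CPhi * ((chi ^ n + INR (n.+1)`!) / chi ^ n.+2) * (al * (eps * M)).
  by rewrite /beta [n.+1.-1]/=; ring.
have aM : 0 <= al * (eps * M).
  by apply: Rmult_le_pos alpha_ge0 _; apply: Rmult_le_pos; lra.
apply: RInt_kernel_weighted_le => //; [lra|exact: ex_RInt_minus|].
move=> s [s0 sxi]; have sI : Icc 0 L s by rewrite /Icc; lra.
have ts0 : 0 <= xi - s by lra.
rewrite -Rmult_minus_distr_l Rabs_mult.
apply: Rmult_le_compat; try exact: Rabs_pos.
  by apply: Phim_le => //; exact: slow_variable.
have -> : source z xi s - source z' xi s =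
  sum_f_R0 (fun k => (a k (eps * s) - a k (eps * xi)) * (fun k s => z k s - z' k s) k.+1 s) n.
  rewrite /source (_ : forall p q r : R, p + r - (q + r) = p - q); last by move=> *; ring.
  by rewrite -minus_sum; apply: eq_sum_f_R0 => k kn; ring.
apply: Rle_trans (coef_diff_le (z := fun k s => z k s - z' k s) (fun k kn => zM k s kn sI) xiI sI) _.
rewrite Rabs_minus_sym (Rabs_pos_eq (xi - s)) //; right; ring.
Qed.

Lemma Ct_ge0 : 0 <= Ct.
Proof.
have := Pi_le (ltn0Sn n) (Rle_refl 0); rewrite Rmult_0_r exp_0 [n.+1.-1]/= => H.
have p0 : 0 <= 0 ^ n by apply: pow_le; lra.
have := Rabs_pos (Pi 0%N 0); nra.
Qed.

Local Notation Mx := (real (Lub_Rbar (fun r => exists zeta,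
  0 < zeta /\ r = (zeta + zeta ^ n.+1) * exp (- chi * zeta)))).

Lemma le_Mx s : 0 < s -> (s + s ^ n.+1) * exp (- chi * s) <= Mx.
Proof.
(* This bound only serves to show that the supremum is finite. *)
move=> s0; apply: (@le_real_Lub _ _ (INR 1`! / chi ^ 1 + INR (n.+1)`! / chi ^ n.+1)).
  by exists s.
move=> _ [t [t0 ->]]; have := pow_exp_le chi_gt0 1 (Rlt_le _ _ t0).
have := pow_exp_le chi_gt0 n.+1 (Rlt_le _ _ t0); rewrite pow_1; lra.
Qed.

Lemma Mx_ge0 : 0 <= Mx.
Proof.
apply: Rle_trans (le_Mx Rlt_0_1); rewrite pow1.
by have := exp_pos (- chi * 1); lra.
Qed.

(** The Lipschitz bound |a_k(eps s) - a_k(0)| <= ||a_k'|| eps s cancels the factor 1/eps, and its s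
    times the bound 1 + s^n on Pi gives the function maximized in gamma. *)
Lemma fterm_le s : Icc 0 L s ->
  Rabs (f s) <= Ct * al * Mx + (if n.+1 == 1%N then Y else 0).
Proof.
move=> sI; have [s0 sL] := sI.
have L0I : Icc 0 L 0 by rewrite /Icc; lra.
apply: Rle_trans (Rabs_triang _ _) _; apply: Rplus_le_compat; last first.
  rewrite Rabs_Ropp; case: eqP => _; last by rewrite Rabs_R0; right.
  by apply: Rabs_le_supnorm (slow_variable sI) => //; lra.
pose P := Ct * (1 + s ^ n) * exp (- chi * s).
have H : Rabs (sum_f_R0 (fun k => (a k (eps * s) - a k 0) * Pi k s) n) <= al * (eps * s * P).
  rewrite alpha_mull; apply: Rabs_sum_f_R0_le => k kn.
  rewrite Rabs_mult (_ : N k * _ = N k * (eps * s) * P); last by ring.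
  apply: Rmult_le_compat; try exact: Rabs_pos; last exact: Pi_le.
  have := a_lipschitz kn (slow_variable sI) (slow_variable L0I).
  by rewrite Rmult_0_r Rminus_0_r Rabs_mult (Rabs_pos_eq eps) ?(Rabs_pos_eq s); lra.
rewrite Rabs_mult Rabs_inv (Rabs_pos_eq eps); last by lra.
apply: Rle_trans (Rmult_le_compat_l _ _ _ _ H) _.
  by left; apply: Rinv_0_lt_compat.
rewrite /P (_ : / eps * _ = Ct * al * ((s + s ^ n.+1) * exp (- chi * s))); last first.
  by rewrite [s ^ n.+1]/=; field; lra.
apply: Rmult_le_compat_l; first by apply: Rmult_le_pos Ct_ge0 alpha_ge0.
(* The maximum runs over zeta > 0 only, so s = 0 is treated apart. *)
have [->|sn0] := Req_dec s 0; last by apply: le_Mx; lra.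
by rewrite [0 ^ n.+1]/= Rmult_0_l Rplus_0_l Rmult_0_l; exact: Mx_ge0.
Qed.

Lemma Ahat0_le i xi : (i <= n)%N -> Icc 0 L xi ->
  Rabs (A (fun _ _ => 0) i.+1 xi) <= CPhi * gamma n.+1 X da dybar chi Ct.
Proof.
move=> ileqn xiI; have [xi0 xiL] := xiI.
have CPhi0 := Rlt_le _ _ CPhi_gt0; have Y0 := supnorm_dybar_ge0.
pose K := CPhi * ((chi ^ n + INR n`!) / chi ^ n.+1).
pose Q := Ct * al * Mx.
(* The norm of ybar' is charged once: to the Phi^1 integral if m >= 2, to f if m = 1. *)
have -> : CPhi * gamma n.+1 X da dybar chi Ct =
    K * (if n.+1 == 1%N then 0 else Y) + K * (Q + (if n.+1 == 1%N then Y else 0)).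
  by rewrite /gamma [n.+1.-1]/= /K /Q; case: eqP => _; ring.
apply: Rle_trans (Rabs_triang _ _) _; apply: Rplus_le_compat.
  rewrite Rabs_Ropp ltnS lt0n; change (n.+1 == 1%N) with (n == 0%N).
  case: eqP => _ /=; first by rewrite Rabs_R0; lra.
  apply: (RInt_kernel_le chi_gt0 CPhi0) => //.
    apply: ex_RInt_Icc => //; apply: cont_on_mult; first by apply: kernel_cont; auto.
    by apply: cont_on_sub (cont_slow dybar_cont) => s; exact: Icc_trans.
  move=> s sI; rewrite Rabs_mult; apply: Rmult_le_compat; try exact: Rabs_pos.
    by apply: Phi1_le => //; [lra|exact: slow_variable].
  by apply: Rabs_le_supnorm => //; [lra|apply: slow_variable; exact: Icc_trans sI].
have cz0 : cont_components (fun _ _ => 0) by move=> k kn; exact: cont_on_const.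
have e := ex_RInt_source cz0 ileqn xiI.
apply: (RInt_kernel_le chi_gt0 CPhi0) => //.
  apply: Rplus_le_le_0_compat; last by case: eqP => _; lra.
  by apply: Rmult_le_pos Mx_ge0; apply: Rmult_le_pos Ct_ge0 alpha_ge0.
move=> s sI; have sL := Icc_trans xiI sI.
rewrite Rabs_mult; apply: Rmult_le_compat; try exact: Rabs_pos.
  by apply: Phim_le => //; [case: sI; lra|exact: slow_variable].
rewrite (@eq_sum_f_R0 _ (fun=> 0)); last by move=> k kn; ring.
by rewrite sum_cte Rmult_0_l Rplus_0_l; exact: fterm_le.
Qed.

(** * The rescaled remainder as a fixed point, and the iteration error *)

Section Remainder.
Variable y : nat -> R -> R.
Hypothesis y_sol : classical_solution n.+1 X a b y0 eps y.

(* The component z^i of the fixed point of Ahat, for [1 <= i <= n.+1]. *)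
Definition remainder i s : R :=
  (eps ^ i.-1 * y i.-1 (eps * s) - Pi i.-1 s
   - ybar a b (eps * s) * (if i.-1 == 0%N then 1 else 0)) / eps.

Lemma solution_cont k : (k <= n)%N -> cont_on (Icc 0 X) (y k).
Proof.
have [dy [cy _]] := y_sol; rewrite leq_eqVlt => /orP[/eqP -> //|kn].
exact: deriv_on_cont (dy k kn).
Qed.

Lemma remainder_cont : cont_components remainder.
Proof.
move=> k kn; rewrite /remainder /=; apply: cont_on_mult; last exact: cont_on_const.
apply: cont_on_minus.
  apply: cont_on_minus; last exact: Pi_cont.
  by apply: cont_on_scal; apply: cont_slow; exact: solution_cont.
apply: cont_on_mult; last exact: cont_on_const.
by apply: cont_slow; exact: deriv_on_cont ybar_deriv.
Qed.

Lemma is_derive_slow g s l : is_derive g (eps * s) l ->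
  is_derive (fun s => g (eps * s)) s (eps * l).
Proof.
move=> dg; have d : is_derive (fun s => eps * s) s eps by auto_derive => //; ring.
exact: is_derive_comp dg d.
Qed.

Lemma is_derive_remainder k s : (k <= n)%N -> 0 < s < L ->
  is_derive (remainder k.+1) s
    ((eps ^ k.+1 * y k.+1 (eps * s) - Pi k.+1 s
      - eps * dybar (eps * s) * (if k == 0%N then 1 else 0)) / eps).
Proof.
move=> kn [s0 sL].
have xI : 0 < eps * s < X.
  split; first exact: Rmult_lt_0_compat.
  by rewrite (_ : X = eps * L); [apply: Rmult_lt_compat_l|field; lra].
have [dy [_ [ydy _]]] := y_sol; have [[dPi _] _] := Pi_def.
have d1 : is_derive (y k) (eps * s) (y k.+1 (eps * s)).
  apply: D_in_is_derive (locally_Icc xI) _; move: kn.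
  rewrite leq_eqVlt => /orP[/eqP ->|kn]; last by apply: dy; rewrite // /Icc; lra.
  by have [] := ydy (eps * s) ltac:(lra).
have d2 : is_derive (Pi k) s (Pi k.+1 s).
  apply: D_in_is_derive (dPi k kn s (Rlt_le _ _ s0)).
  have H : 0 < s < s + 1 by lra.
  by apply: filter_imp (locally_Icc H) => t [].
have d3 : is_derive (ybar a b) (eps * s) (dybar (eps * s)).
  exact: deriv_on_is_derive ybar_deriv xI.
have D1 := is_derive_scal _ _ (eps ^ k) _ (is_derive_slow d1).
have D3 := is_derive_scal _ _ (if k == 0%N then 1 else 0) _ (is_derive_slow d3).
have D := is_derive_scal _ _ (/ eps) _
  (is_derive_minus _ _ _ _ _ (is_derive_minus _ _ _ _ _ D1 d2) D3).
apply: is_derive_ext (is_derive_eq D _) => [t|].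
  by rewrite /remainder /minus /plus /Hierarchy.opp /=; field; lra.
by rewrite /minus /plus /Hierarchy.opp /=; field; lra.
Qed.

(** The initial data of the boundary layer Pi are chosen for this cancellation. *)
Lemma remainder0 k : (k <= n)%N -> remainder k.+1 0 = 0.
Proof.
move=> kn; have [_ [_ [_ yk0]]] := y_sol; have [_ [P0 Pk]] := Pi_def.
rewrite /remainder /= Rmult_0_r yk0 //; case: eqP => [->|/eqP k0].
  by rewrite P0 /=; field; lra.
have ek : eps ^ k <> 0 by apply: pow_nonzero; lra.
rewrite Pk; last by rewrite lt0n k0.
by field; lra.
Qed.

(** The remainder solves z_k' = z_(k+1), with - ybar' added in the first equation, and has sum_l
    a_l(eps s) z_(l+1) + f on the right of the last. Writing a_l(eps s) as a_l(eps xi) plus a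
    difference leaves constant coefficients with forcing [source], to which [variation_of_constants]
    applies at time xi. *)
Lemma remainder_fixed i xi : (i <= n)%N -> Icc 0 L xi ->
  remainder i.+1 xi = A remainder i.+1 xi.
Proof.
move=> ileqn xiI; have [xi0 xiL] := xiI.
have [sPhim Phim0] := Phim_def (slow_variable xiI).
have [sPhi1 Phi10] := Phi1_def (slow_variable xiI).
(* For m = 1 the term - ybar' is already part of f. *)
pose g1 s := if (2 <= n.+1)%N then - dybar (eps * s) else 0.
have cg1 : cont_on (Icc 0 xi) g1.
  rewrite /g1; case: (2 <= n.+1)%N; last exact: cont_on_const.
  apply: cont_on_opp; apply: cont_on_sub (cont_slow dybar_cont) => s; exact: Icc_trans.
have cgm := source_cont remainder_cont xiI.
have xixi : Icc 0 xi xi by rewrite /Icc; lra.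
have H := @variation_of_constants n (fun k => a k (eps * xi)) (Phim (eps * xi))
  (Phi1 (eps * xi)) (fun k => remainder k.+1) g1 (source remainder xi) xi
  (lin_ode_sol_const sPhim) Phim0 (lin_ode_sol_const sPhi1) Phi10 _ cg1 cgm _
  remainder0 i xi ileqn xixi.
have e2 := ex_RInt_source remainder_cont ileqn xiI.
have c1 : cont_on (Icc 0 xi) (fun s => Phi1 (eps * xi) i (xi - s) * dybar (eps * s)).
  apply: cont_on_mult; first by apply: kernel_cont; auto.
  by apply: cont_on_sub (cont_slow dybar_cont) => s; exact: Icc_trans.
have e1 := ex_RInt_Icc xi0 c1.
have {H} H : is_RInt (fun s => Phi1 (eps * xi) i (xi - s) * g1 s
    + Phim (eps * xi) i (xi - s) * source remainder xi s) 0 xi (remainder i.+1 xi).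
  apply: H => [k kn|k s kn sxi].
    by apply: cont_on_sub (remainder_cont kn) => s; exact: Icc_trans.
  have sL : 0 < s < L by lra.
  apply: is_derive_eq (is_derive_remainder kn sL) _.
  have kn_le := kn; move: kn; rewrite leq_eqVlt => /orP[/eqP kE|kn]; last first.
    rewrite kn (ltn_eqF kn) /remainder /g1 ltnS (leq_ltn_trans (leq0n k) kn) /=.
    by field; lra.
  rewrite {}kE in kn_le *; rewrite ltnn eqxx /source /fterm [n.+1.-1]/=.
  have xI := slow_variable (conj (Rlt_le _ _ (proj1 sL)) (Rlt_le _ _ (proj2 sL))).
  have [_ [_ [ydy _]]] := y_sol; have [[_ ePi] _] := Pi_def.
  have xI0 : 0 < eps * s <= X.
    by split; [apply: Rmult_lt_0_compat; lra|case: xI].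
  have [_ ->] := ydy _ xI0; rewrite ePi; last by lra.
  rewrite [n.+1.-1]/=.
  pose T1 := sum_f_R0 (fun l => eps ^ l * a l (eps * s) * y l (eps * s)) n.
  pose T2 := sum_f_R0 (fun l => a l (eps * s) * Pi l s) n.
  pose T3 := sum_f_R0 (fun l => a l 0 * Pi l s) n.
  pose W := sum_f_R0 (fun l => a l (eps * s) * remainder l.+1 s) n.
  have eW : W = (T1 - T2 + b (eps * s)) / eps.
    (* Since b = - a_0 ybar, the inhomogeneity is the ybar part of the remainder inserted into the
       equation. *)
    have -> : b (eps * s) = - sum_f_R0 (fun l => a l (eps * s) * ybar a b (eps * s)
        * (if l == 0%N then 1 else 0)) n.
      by rewrite sum_f_R0_delta // /ybar; field; exact: a0_neq0.
    rewrite /Rdiv Rmult_comm /T1 /T2 /W -minus_sum /Rminus -/(Rminus _ _) -minus_sum scal_sum.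
    by apply: eq_sum_f_R0 => l ln; rewrite /remainder /=; field; lra.
  have eS : sum_f_R0 (fun l => a l (eps * xi) * remainder l.+1 s) n
      + sum_f_R0 (fun l => (a l (eps * s) - a l (eps * xi)) * remainder l.+1 s) n = W.
    by rewrite -plus_sum; apply: eq_sum_f_R0 => l ln; ring.
  have eT : sum_f_R0 (fun l => (a l (eps * s) - a l 0) * Pi l s) n = T2 - T3.
    by rewrite -minus_sum; apply: eq_sum_f_R0 => l ln; ring.
  rewrite -/T1 -/T3 eT /g1 ltnS lt0n; change (n.+1 == 1%N) with (n == 0%N).
  set S1 := sum_f_R0 _ n in eS *; set S2 := sum_f_R0 _ n in eS *.
  have -> : S1 = W - S2 by lra.
  by rewrite eW; case: eqP => _ /=; field; lra.
rewrite -(is_RInt_unique _ _ _ _ H) /Ahat [i.+1.-1]/=.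
have -> : RInt (fun s => Phi1 (eps * xi) i (xi - s) * g1 s
    + Phim (eps * xi) i (xi - s) * source remainder xi s) 0 xi =
  RInt (fun s => Phi1 (eps * xi) i (xi - s) * g1 s) 0 xi
  + RInt (fun s => Phim (eps * xi) i (xi - s) * source remainder xi s) 0 xi.
  apply: RInt_plus e2; apply: ex_RInt_Icc xi0 _.
  by apply: cont_on_mult; [apply: kernel_cont; auto|].
congr (_ + _); rewrite /g1; case: (2 <= n.+1)%N.
  have E : RInt (fun s => - (Phi1 (eps * xi) i (xi - s) * dybar (eps * s))) 0 xi =
    - RInt (fun s => Phi1 (eps * xi) i (xi - s) * dybar (eps * s)) 0 xi := RInt_opp _ _ _ e1.
  by rewrite -E; apply: RInt_ext => s _; rewrite -Ropp_mult_distr_r.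
rewrite Ropp_0 (RInt_ext _ (fun=> 0)); last by move=> s _; rewrite Rmult_0_r.
by rewrite RInt_const /scal /= /mult /= Rmult_0_r.
Qed.

Local Notation q := (eps * (CPhi * beta n.+1 X da chi)).

(** The supremum M is finite by continuity. Splitting A z = (A z - A 0) + A 0 gives M <= q M + C_Phi
    gamma, which is solved for M using q <= gamma_0. *)
Lemma remainder_le gamma0 : q <= gamma0 -> gamma0 < 1 ->
  forall k s, (k <= n)%N -> Icc 0 L s ->
  Rabs (remainder k.+1 s) <= C0 n.+1 X da dybar chi CPhi Ct gamma0.
Proof.
move=> qg g1.
pose E r := exists k s, (k <= n)%N /\ Icc 0 L s /\ r = Rabs (remainder k.+1 s).
have L0I : Icc 0 L 0 by have := stretched_length_ge0; rewrite /Icc; lra.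
have [B B0 HB] := cont_components_bounded remainder_cont.
have bE : bound E by exists B => _ [k [s [kn [sI ->]]]]; exact: HB.
have neE : exists r, E r by exists (Rabs (remainder 1 0)), 0%N, 0.
have [M [ubM lubM]] := completeness E bE neE.
have leM k s : (k <= n)%N -> Icc 0 L s -> Rabs (remainder k.+1 s) <= M.
  by move=> kn sI; apply: ubM; exists k, s.
have M0 : 0 <= M := Rle_trans _ _ _ (Rabs_pos _) (leM 0%N 0 (leq0n n) L0I).
have cz0 : cont_components (fun _ _ => 0) by move=> k kn; exact: cont_on_const.
have ME : M <= q * M + CPhi * gamma n.+1 X da dybar chi Ct.
  apply: lubM => _ [k [s [kn [sI ->]]]].
  rewrite (remainder_fixed kn sI).
  have H1 := Ahat_contraction (M := M) remainder_cont cz0 _ kn sI.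
  have {H1} H1 := H1 (fun l t ln tI => eq_ind_r (fun r => Rabs r <= M) (leM l t ln tI) (Rminus_0_r _)).
  have H2 := Ahat0_le kn sI.
  rewrite -[A remainder k.+1 s](Rplus_minus (A (fun _ _ => 0) k.+1 s)).
  by apply: Rle_trans (Rabs_triang _ _) _; lra.
move=> k s kn sI; apply: Rle_trans (leM k s kn sI) _; rewrite /C0.
apply: (Rmult_le_reg_r (1 - gamma0)); first lra.
rewrite (_ : _ / _ * _ = CPhi * gamma n.+1 X da dybar chi Ct); last by field; lra.
have := Rmult_le_compat_r _ _ _ M0 qg; lra.
Qed.

Lemma iteration_error gamma0 p : q <= gamma0 -> gamma0 < 1 ->
  forall k s, (k <= n)%N -> Icc 0 L s ->
  Rabs (remainder k.+1 s - phi_iter n.+1 a dybar Pi Phi1 Phim eps p k.+1 s)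
    <= C0 n.+1 X da dybar chi CPhi Ct gamma0 * q ^ p.
Proof.
move=> qg g1; elim: p => [|p IH] k s kn sI.
  by rewrite /= Rminus_0_r Rmult_1_r; exact: remainder_le.
rewrite (remainder_fixed kn sI).
apply: Rle_trans (Ahat_contraction remainder_cont (@phi_iter_cont p) IH kn sI) _.
by right; rewrite [_ ^ p.+1]/=; ring.
Qed.

End Remainder.
End Main.

(** * Constants of the statement, and the conclusion *)

Lemma chi_pos m X a chi :
  (forall x, Icc 0 X x -> routh_hurwitz m (fun k => a k x)) -> is_chi m X a chi -> 0 < chi.
Proof.
move=> RH [[x [w [xI [root_w E]]]] _].
have := routh_hurwitz_stable (RH x xI) root_w; rewrite -E; lra.
Qed.

(** The first Routh-Hurwitz inequality says a_0 < 0, so ybar is a quotient of C^1 functions with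
    nonvanishing denominator. *)
Lemma ybar_deriv_cont m X a b dybar : 0 < X -> (1 <= m)%N ->
  C1_on (Icc 0 X) (a 0%N) -> C1_on (Icc 0 X) b ->
  (forall x, Icc 0 X x -> routh_hurwitz m (fun k => a k x)) ->
  deriv_on (Icc 0 X) (ybar a b) dybar -> cont_on (Icc 0 X) dybar.
Proof.
move=> X0 m1 ca [db [dbP cdb]] RH; apply: quotient_deriv_cont => //.
  exists (fun x => - db x); split; last exact: cont_on_opp.
  by move=> x xI; apply: Dopp; exact: dbP.
by move=> x xI; have := routh_hurwitz_a0_lt0 m1 (RH x xI); lra.
Qed.

(** The ratio of the statement is the contraction constant q. For beta = 0 both sides are 0, as a
    finite number divided by [p_infty] is 0. *)
Lemma eps_ratioE m X da chi CPhi gamma0 eps : 0 < CPhi ->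
  0 <= beta m X da chi -> 0 < gamma0 ->
  gamma0 * eps_ratio m X da chi CPhi gamma0 eps = eps * (CPhi * beta m X da chi).
Proof.
move=> C0 b0 g0; rewrite /eps_ratio /eps0; case: Req_EM_T => [bz|bn0] /=; first by rewrite bz; ring.
by field; split; [|split]; lra.
Qed.

Lemma le_eps0 m X da chi CPhi gamma0 eps : 0 < CPhi ->
  0 <= beta m X da chi -> 0 < gamma0 ->
  Rbar_le (Rbar.Finite eps) (eps0 m X da chi CPhi gamma0) ->
  eps * (CPhi * beta m X da chi) <= gamma0.
Proof.
move=> C0 b0 g0; rewrite /eps0; case: Req_EM_T => [bz|bn0] /=; first by rewrite bz; lra.
have Cb : 0 < CPhi * beta m X da chi by apply: Rmult_lt_0_compat; lra.
move=> H; have := Rmult_le_compat_r _ _ _ (Rlt_le _ _ Cb) H.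
by rewrite (_ : gamma0 * _ * _ = gamma0) //; field; split; lra.
Qed.

Theorem mainTheorem1
  (m : nat) (X : R) (a da : nat -> R -> R) (b dybar : R -> R) (y0 : nat -> R)
  (Pi : nat -> R -> R) (Phi1 Phim : R -> nat -> R -> R)
  (chi CPhi Ct gamma0 : R)
  (m_ge1 : (1 <= m)%N) (X_gt0 : 0 < X)
  (a_C1 : forall k, (k < m)%N -> C1_on (Icc 0 X) (a k))
  (b_C1 : C1_on (Icc 0 X) b)
  (a_RH : forall x, Icc 0 X x -> routh_hurwitz m (fun k => a k x))
  (a_deriv : forall k, (k < m)%N -> deriv_on (Icc 0 X) (a k) (da k))
  (ybar_deriv : deriv_on (Icc 0 X) (ybar a b) dybar)
  (Pi_def : is_Pi m a b y0 Pi)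
  (Phi1_def : is_Phi1 m X a Phi1)
  (Phim_def : is_Phim m X a Phim)
  (chi_def : is_chi m X a chi)
  (CPhi_gt0 : 0 < CPhi)
  (Phi1_le : Phi_bound m X Phi1 chi CPhi)
  (Phim_le : Phi_bound m X Phim chi CPhi)
  (Pi_le : Pi_bound m Pi chi Ct)
  (gamma0_01 : 0 < gamma0 < 1)
  (eps : R) (eps_gt0 : 0 < eps)
  (eps_le : Rbar_le (Rbar.Finite eps) (eps0 m X da chi CPhi gamma0))
  (y : nat -> R -> R) (y_sol : classical_solution m X a b y0 eps y) :
  (forall n : nat,
     Rbar_le
       (supnorm X (fun x =>
          y 0%N x - y_iter m a b dybar Pi Phi1 Phim eps n 1%N x))
       (Rbar.Finite (C0 m X da dybar chi CPhi Ct gamma0 * eps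
                * (gamma0 * eps_ratio m X da chi CPhi gamma0 eps) ^ n)) /\
     (forall i : nat, (2 <= i <= m)%N ->
        Rbar_le
          (supnorm X (fun x =>
             y (i - 1)%N x - y_iter m a b dybar Pi Phi1 Phim eps n i x))
          (Rbar.Finite (C0 m X da dybar chi CPhi Ct gamma0 * / eps ^ (i - 2)
                   * (gamma0 * eps_ratio m X da chi CPhi gamma0 eps) ^ n)))) /\
  converges_Cm m X
    (fun n => y_iter m a b dybar Pi Phi1 Phim eps n)
    (fun i => y (i - 1)%N).
Proof.
have chi_gt0 := chi_pos a_RH chi_def.
have dybar_cont := ybar_deriv_cont X_gt0 m_ge1 (a_C1 0%N m_ge1) b_C1 a_RH ybar_deriv.
have a0_neq0 x : Icc 0 X x -> a 0%N x <> 0.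
  by move=> xI; have := routh_hurwitz_a0_lt0 m_ge1 (a_RH x xI); lra.
case: m => [//|n] in m_ge1 a_C1 a_RH a_deriv Pi_def Phi1_def Phim_def chi_def
  Phi1_le Phim_le Pi_le eps_le y_sol *.
have a_cont k : (k <= n)%N -> cont_on (Icc 0 X) (a k).
  by move=> kn; exact: deriv_on_cont (a_deriv k kn).
have da_cont k : (k <= n)%N -> cont_on (Icc 0 X) (da k).
  by move=> kn; exact: C1_on_deriv_cont X_gt0 (a_C1 k kn) (a_deriv k kn).
have beta_ge0 : 0 <= beta n.+1 X da chi.
  apply: Rmult_le_pos; first exact: alpha_ge0.
  apply: Rle_trans (kernel_first_moment_le n chi_gt0 (Rle_refl 0)).
  by rewrite !exp_moment0 //; lra.
have [g0 g1] := gamma0_01.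
have ratioE := eps_ratioE eps CPhi_gt0 beta_ge0 g0.
have q_le := le_eps0 CPhi_gt0 beta_ge0 g0 eps_le.
set q := eps * _ in ratioE q_le.
have q0 : 0 <= q by apply: Rmult_le_pos; [lra|apply: Rmult_le_pos; lra].
set K := C0 _ _ _ _ _ _ _ _.
pose z p := phi_iter n.+1 a dybar Pi Phi1 Phim eps p.
have err p k x : (k <= n)%N -> Icc 0 X x ->
    Rabs (remainder a b Pi eps y k.+1 (x / eps) - z p k.+1 (x / eps)) <= K * q ^ p.
  move=> kn xI.
  exact: (iteration_error (da := da) X_gt0 chi_gt0 a_cont a_deriv da_cont a0_neq0 ybar_deriv
    dybar_cont Pi_def Phi1_def Phim_def CPhi_gt0 Phi1_le Phim_le Pi_le eps_gt0 y_sol _ q_le g1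
    kn (fast_variable eps_gt0 xI)).
have epsE x : eps * (x / eps) = x by field; lra.
have err1 p x : Icc 0 X x ->
    Rabs (y 0%N x - y_iter n.+1 a b dybar Pi Phi1 Phim eps p 1 x) <= K * eps * q ^ p.
  (* The leading term ybar + Pi occurs in both y and its iterate and cancels. *)
  move=> xI; rewrite (_ : _ - _ = eps * (remainder a b Pi eps y 1 (x / eps) - z p 1%N (x / eps))).
    rewrite Rabs_mult (Rabs_pos_eq eps); last by lra.
    rewrite (_ : K * eps * q ^ p = eps * (K * q ^ p)); last by ring.
    by apply: Rmult_le_compat_l; [lra|exact: err].
  by rewrite /y_iter /ytilde /remainder /= epsE -/(z p); field; lra.
have erri p i x : (2 <= i <= n.+1)%N -> Icc 0 X x ->
    Rabs (y (i - 1)%N x - y_iter n.+1 a b dybar Pi Phi1 Phim eps p i x)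
      <= K * / eps ^ (i - 2) * q ^ p.
  case: i => [//|[//|i]] /= i_le xI; rewrite subSS subn0 !subSS subn0.
  have ei : 0 < eps ^ i by apply: pow_lt.
  rewrite (_ : _ - _ = / eps ^ i * (remainder a b Pi eps y i.+2 (x / eps) - z p i.+2 (x / eps))).
    rewrite Rabs_mult (Rabs_pos_eq (/ eps ^ i)); last by left; apply: Rinv_0_lt_compat.
    rewrite (_ : K * _ * q ^ p = / eps ^ i * (K * q ^ p)); last by ring.
    by apply: Rmult_le_compat_l; [left; apply: Rinv_0_lt_compat|exact: err].
  rewrite /y_iter /remainder /= epsE -/(z p) !subSS !subn0.
  by field; lra.
split=> [p|].
  rewrite ratioE; split=> [|i i_le]; apply: supnorm_le => x xI; [exact: err1|exact: erri].
have cfast g : cont_on (Icc 0 (X / eps)) g -> cont_on (Icc 0 X) (fun x => g (x / eps)).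
  move=> cg; apply: cont_on_comp (cg) _; first by move=> x; exact: fast_variable.
  apply: cont_on_mult; last exact: cont_on_const.
  by apply: cont_on_continuous => x _; exact: continuous_id.
split=> [p i|].
  case: i => [//|i] /= i_le.
  have cz : cont_on (Icc 0 X) (fun x => z p i.+1 (x / eps)).
    by apply: cfast; apply: (@phi_iter_cont n X a da b dybar y0 Pi Phi1 Phim chi CPhi eps).
  have cP : cont_on (Icc 0 X) (fun x => Pi i (x / eps)).
    by apply: cfast; exact: (Pi_cont Pi_def).
  rewrite /y_iter; case: i i_le cz cP => [|i] i_le cz cP /=.
    apply: cont_on_plus; last exact: cont_on_scal.
    by apply: cont_on_plus => //; exact: deriv_on_cont ybar_deriv.
  by rewrite subSS subn0; apply: cont_on_plus; apply: cont_on_scal.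
split=> [i|delta delta0].
  by case: i => [//|i] /= i_le; rewrite subSS subn0; exact: solution_cont y_sol _ _.
(* Component k + 1 has error bound K eps^(1-k) q^p. As eps may lie on either side of 1, the sum over
   k is taken to dominate all components at once. *)
pose Cm := sum_f_R0 (fun k => Rabs (K * eps * / eps ^ k)) n.
have Cm0 : 0 <= Cm by apply: sum_f_R0_ge0 => k _; exact: Rabs_pos.
have q1 : Rabs q < 1 by rewrite Rabs_pos_eq; lra.
(* Cm may be 0; dividing by Cm + 1 avoids this case and makes the final inequality strict. *)
have [P HP] := pow_lt_1_zero q q1 (delta / (Cm + 1)) ltac:(apply: Rdiv_lt_0_compat; lra).
exists P => p /leP Pp.
have {HP} qp : q ^ p < delta / (Cm + 1).
  by apply: Rle_lt_trans (HP p Pp); exact: Rle_abs.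
apply: (@Rbar_le_lt_trans _ (Rbar.Finite (Cm * q ^ p))); last first.
  have qp0 := pow_le q p q0.
  have : (Cm + 1) * q ^ p < (Cm + 1) * (delta / (Cm + 1)) by apply: Rmult_lt_compat_l; lra.
  rewrite (_ : (Cm + 1) * (delta / (Cm + 1)) = delta) /=; [nra|field; lra].
apply: supnorm_vec_le => i x i_le xI; rewrite Rabs_minus_sym.
case: i i_le => [//|i] /= i_le.
have leCm : K * eps * / eps ^ i <= Cm.
  apply: Rle_trans (Rle_abs _) _.
  by apply: (@term_le_sum_f_R0 (fun k => Rabs (K * eps * / eps ^ k))) => // k _; exact: Rabs_pos.
apply: Rle_trans (Rmult_le_compat_r _ _ _ (pow_le q p q0) leCm).
case: i i_le {leCm} => [|i] i_le.
  by rewrite subnn Rinv_1 Rmult_1_r; exact: err1.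
have := erri p i.+2 x i_le xI; rewrite !subSS !subn0.
rewrite (_ : K * eps * / eps ^ i.+1 = K * / eps ^ i) //.
have ei : eps ^ i <> 0 by apply: pow_nonzero; lra.
by rewrite [eps ^ i.+1]/=; field; lra.
Qed.
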